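(* For any odd integer $d\ge 3$ and any $\rho\le \frac{n}{\lfloor d/2\rfloor}$, there is a $\rho$-approximation algorithm for $d$-Scattered Set on $n$-vertex graphs with running time $O^*((e\rho d)^{\frac{2n}{\rho(d+\rho)}})$.
   Context: All graphs are finite, simple and undirected; $d_G(u,v)$ is the shortest-path distance. A $d$-scattered set of $G$ is a set $K\subseteq V(G)$ with $d_G(u,v)\ge d$ for all distinct $u,v\in K$; $OPT_d(G)$ is its maximum size. A $\rho$-approximation algorithm outputs a $d$-scattered set of size at least $OPT_d(G)/\rho$. $O^*(\cdot)$ suppresses factors polynomial in the input size; $e$ is Euler's number. *)

(* Defs.v *)
From mathcomp Require Import all_boot all_order all_algebra.

Set Implicit Arguments.
Unset Strict Implicit.
Unset Printing Implicit Defensive.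

Import GRing.Theory Num.Theory.

Section Graphs.
Variables (T : finType) (E : rel T).

Definition walk (u v : T) (k : nat) : bool :=
  [exists p : k.-tuple T, path E u p && (last u p == v)].

Lemma connect_walk u v : connect E u v -> exists k, walk u v k.
Proof.
case/connectP=> p Ep ->; exists (size p); apply/existsP.
by exists (in_tuple p); rewrite Ep eqxx.
Qed.

(* Shortest-path distance; None stands for infinity (no path). *)
Definition dist (u v : T) : option nat :=
  if @idP (connect E u v) is ReflectT uv then Some (ex_minn (connect_walk uv))
  else None.

Definition dist_geq (d : nat) (u v : T) : bool :=
  if dist u v is Some k then d <= k else true.

Definition scattered (d : nat) (K : {set T}) : bool :=
  [forall u in K, forall v in K, (u != v) ==> dist_geq d u v].

Definition OPT (d : nat) : nat := \max_(K : {set T} | scattered d K) #|K|.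

End Graphs.

(* Algorithms are programs of a random access machine with finitely many       *)
(* named registers and arrays of natural numbers, run under a logarithmic      *)
(* cost criterion. Unit cost would be unsound here: it would allow arithmetic  *)
(* on exponentially long numbers, which is not a polynomial overhead in the    *)
(* input size.                                                                 *)

Inductive binop := Add | Sub | Mul | Div.

Inductive expr :=
  | Const of nat
  | Reg of nat
  | Read of nat & expr               (* Read a e: cell e of array a *)
  | Bin of binop & expr & expr.

Inductive com :=
  | Skip
  | Assign of nat & expr             (* Assign x e: register x := e *)
  | Write of nat & expr & expr       (* Write a e1 e2: array a, cell e1 := e2 *)
  | Seq of com & com
  | If of expr & com & com           (* nonzero means true *)
  | While of expr & com.

Record state := State { reg : nat -> nat; arr : nat -> nat -> nat }.

Definition set_reg (s : state) (x v : nat) : state :=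
  State (fun y => if y == x then v else reg s y) (arr s).

Definition set_arr (s : state) (a i v : nat) : state :=
  State (reg s) (fun b j => if (b == a) && (j == i) then v else arr s b j).

(* Sub is truncated, and division by 0 yields 0. *)
Definition binop_eval (o : binop) (v w : nat) : nat :=
  match o with
  | Add => v + w
  | Sub => v - w
  | Mul => v * w
  | Div => v %/ w
  end.

Fixpoint eval (s : state) (e : expr) : nat :=
  match e with
  | Const c => c
  | Reg x => reg s x
  | Read a e1 => arr s a (eval s e1)
  | Bin o e1 e2 => binop_eval o (eval s e1) (eval s e2)
  end.

(* Length of the binary numeral of v, with 0 of length 1. *)
Definition bitlen (v : nat) : nat := (trunc_log 2 v).+1.

(* Accessing a number costs its length, on top of the cost of computing its    *)
(* address; an arithmetic operation is charged the cost of schoolbook          *)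
(* multiplication.                                                             *)
Fixpoint ecost (s : state) (e : expr) : nat :=
  match e with
  | Const c => bitlen c
  | Reg x => bitlen (reg s x)
  | Read a e1 => ecost s e1 + bitlen (eval s e1) + bitlen (eval s e)
  | Bin o e1 e2 =>
      ecost s e1 + ecost s e2 + bitlen (eval s e1) * bitlen (eval s e2)
  end.

(* exec c s t s': started in s, the program c halts in s' at total cost t. *)
Inductive exec : com -> state -> nat -> state -> Prop :=
  | ExecSkip s : exec Skip s 1 s
  | ExecAssign x e s :
      exec (Assign x e) s (ecost s e).+1 (set_reg s x (eval s e))
  | ExecWrite a e1 e2 s :
      exec (Write a e1 e2) s
        (ecost s e1 + bitlen (eval s e1) + ecost s e2).+1
        (set_arr s a (eval s e1) (eval s e2))
  | ExecSeq c1 c2 s t1 s1 t2 s2 :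
      exec c1 s t1 s1 -> exec c2 s1 t2 s2 -> exec (Seq c1 c2) s (t1 + t2).+1 s2
  | ExecIf e c1 c2 s t s1 :
      exec (if eval s e != 0 then c1 else c2) s t s1 ->
      exec (If e c1 c2) s (ecost s e + t).+1 s1
  | ExecWhileFalse e c s :
      eval s e = 0 -> exec (While e c) s (ecost s e).+1 s
  | ExecWhileTrue e c s t1 s1 t2 s2 :
      eval s e != 0 -> exec c s t1 s1 -> exec (While e c) s1 t2 s2 ->
      exec (While e c) s (ecost s e + t1 + t2).+1 s2.

(* Input: registers 0-3 hold n, d and the numerator and denominator of q, the  *)
(* rational approximation of the desired ratio; array 0 holds the adjacency    *)
(* matrix, row by row; everything else is 0.                                   *)
Definition init_state (n d : nat) (q : rat) (E : rel 'I_n) : state :=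
  State (nth 0 [:: n; d; `|numq q|%N; `|denq q|%N])
        (fun a i => [&& a == 0 &
           [exists u : 'I_n, exists v : 'I_n, (i == u * n + v) && E u v]]).

Definition input_size (n d : nat) (q : rat) : nat :=
  n * n + bitlen n + bitlen d + bitlen `|numq q|%N + bitlen `|denq q|%N.

(* Output: the characteristic vector of a vertex set, in array 1. *)
Definition output (n : nat) (s : state) : {set 'I_n} :=
  [set v : 'I_n | arr s 1 v != 0].

(* Main.v *)
(* Let [h = d./2], [f = floor q] and call a vertex small if its [h]-ball has   *)
(* at most [h + f] elements. If [K] is scattered and at least two of its       *)
(* vertices are within distance [2 h] of [v], then their number plus [h] is at *)
(* most the size of the [h]-ball of [v]; hence picking a small vertex greedily *)
(* destroys at most [f <= rho] vertices of an optimal solution. What is left   *)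
(* of the optimum after the greedy phase consists of vertices with disjoint    *)
(* [h]-balls of more than [h + q] elements, so there are at most [n / (h + q)] *)
(* of them, and it suffices to extend the greedy set optimally by at most      *)
(* [n / (q (h + q)) + 1] vertices, by exhaustive search. The number of sets    *)
(* searched is estimated by [C(n, i) <= e^x (n / x)^i], where [x] is the       *)
(* exponent of the theorem.                                                    *)
Require Import Defs.
From mathcomp Require Import all_boot all_order all_algebra.
From mathcomp Require Import reals sequences exp.
From mathcomp Require Import zify ring lra.

Set Implicit Arguments.
Unset Strict Implicit.
Unset Printing Implicit Defensive.

(** * A cost-aware program logic *)

(** Write [d = 2 h + 1] and let [f] be the integer part of [q]. The greedy phase keeps a vertex if
    its [h]-ball has at most [h + f] elements and it is at distance at least [d] from all vertices
    kept before; let [S] be the result. By [card_scattered_near] each vertex of [S] has at most [f]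
    vertices of an optimum within distance [2 h]. By maximality of [S], every other vertex of the
    optimum has an [h]-ball of at least [h + f + 1] elements. These balls are disjoint, so there are
    [b <= n / (h + f + 1)] such vertices ([greedy_outcome_ratio]). Searching all extensions of [S]
    by at most [k = floor (n / (q (h + f + 1))) + 1] vertices either recovers [b] further vertices
    or finds [k >= b / q] of them. Both losses stay within the factor [rho] ([output_ratio]).

    The search is a depth-first enumeration whose number of iterations is at most twice the number
    of sets of at most [k] vertices ([search_explore], [visits_binomial]). Let [X] be the exponent
    of the theorem and [y = n / X = rho (d + rho) / 2]. Then [C(n, i) <= e^X y^i]. Up to a bounded
    additive term, [k] is at most [X' = n / (rho (h + rho))] ([exponent_rounding]), and
    [y^X' <= (rho d)^X] ([powR_exponent_tradeoff]); this yields the claimed bound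
    ([sum_bin_search]).

    On the machine side, the triples [runs] count steps. As all stored numbers have at most [L]
    bits, with [L] polynomial in the input size, each step costs [O(L^2)], and the logarithmic cost
    criterion adds only a polynomial factor ([total_cost]). *)

Fixpoint expr_size (e : expr) : nat :=
  match e with
  | Const _ | Reg _ => 1
  | Read _ e1 => (expr_size e1).+1
  | Bin _ e1 e2 => expr_size e1 + expr_size e2
  end.

Fixpoint small_consts (e : expr) : bool :=
  match e with
  | Const c => c <= 1
  | Reg _ => true
  | Read _ e1 => small_consts e1
  | Bin o e1 e2 => small_consts e1 && small_consts e2
  end.

(** A syntactic class wide enough for the expressions of the program, which makes a uniform cost per
    step possible. *)
Definition small (e : expr) : bool := (expr_size e <= 20) && small_consts e.

Definition bounded (L : nat) (s : state) : Prop :=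
  (forall x, reg s x < 2 ^ L) /\ (forall a i, arr s a i < 2 ^ L).

Lemma expr_size_gt0 e : 0 < expr_size e.
Proof. by elim: e => //= o e1 h1 e2 _; rewrite addn_gt0 h1. Qed.

Lemma bitlen_leq v l : 0 < l -> v < 2 ^ l -> bitlen v <= l.
Proof.
move=> l_gt0 v_lt; rewrite /bitlen; case: (posnP v) => [->|v_gt0].
  by rewrite trunc_log0.
by rewrite -(ltn_exp2l _ _ (isT : 1 < 2)) (leq_ltn_trans (trunc_logP _ _)).
Qed.

Lemma ltn_exp2_bitlen v l : bitlen v <= l -> v < 2 ^ l.
Proof.
by move=> vl; apply: leq_trans (trunc_log_ltn _ (isT : 1 < 2)) _; rewrite leq_exp2l.
Qed.

Lemma bounded_set_reg L s x v :
  bounded L s -> v < 2 ^ L -> bounded L (set_reg s x v).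
Proof. by move=> [br ba] vL; split=> //= y; case: ifP. Qed.

Lemma bounded_set_arr L s a i v :
  bounded L s -> v < 2 ^ L -> bounded L (set_arr s a i v).
Proof. by move=> [br ba] vL; split=> //= b j; case: ifP. Qed.

Section Cost.
Variable L : nat.
Hypothesis L_gt0 : 0 < L.

(** Every leaf is below [2 ^ L], and since the bounds of both operands are at least 2, no operation
    reaches their product. *)
Lemma eval_lt s e :
  bounded L s -> small_consts e -> eval s e < 2 ^ (L * expr_size e).
Proof.
move=> [br ba]; elim: e => [c|x|a e1 IH|o e1 IH1 e2 IH2] /=.
- move=> c1; rewrite muln1 (leq_ltn_trans c1) //.
  by rewrite -[1]/(2 ^ 0) ltn_exp2l.
- by rewrite muln1.
- move=> _; apply: leq_trans (ba _ _) _.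
  by rewrite leq_exp2l // leq_pmulr.
case/andP=> /IH1 h1 /IH2 h2; rewrite mulnDr expnD.
set A := 2 ^ _ in h1 *; set B := 2 ^ _ in h2 *.
have A2 : 1 < A by rewrite -[1]/(2 ^ 0) ltn_exp2l // muln_gt0 L_gt0 expr_size_gt0.
have B2 : 1 < B by rewrite -[1]/(2 ^ 0) ltn_exp2l // muln_gt0 L_gt0 expr_size_gt0.
case: o => /=; [nia|nia|nia|].
by apply: leq_ltn_trans (leq_div _ _) _; nia.
Qed.

Lemma bitlen_eval s e :
  bounded L s -> small_consts e -> bitlen (eval s e) <= L * expr_size e.
Proof.
move=> bs se; apply: bitlen_leq (eval_lt bs se).
by rewrite muln_gt0 L_gt0 expr_size_gt0.
Qed.

Lemma ecost_leq s e :
  bounded L s -> small_consts e -> ecost s e <= 3 * (L * expr_size e) ^ 2.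
Proof.
move=> bs; elim: e => [c|x|a e1 IH|o e1 IH1 e2 IH2].
- move=> sc; have /= := bitlen_eval bs sc; rewrite !muln1; nia.
- move=> sc; have /= := bitlen_eval bs sc; rewrite !muln1; nia.
- move=> /= sc; have := IH sc; have := bitlen_eval bs sc.
  have := bitlen_leq L_gt0 (bs.2 a (eval s e1)).
  rewrite -!mulnn; nia.
move=> /= /andP[s1 s2]; have := IH1 s1; have := IH2 s2.
have b1 := bitlen_eval bs s1; have b2 := bitlen_eval bs s2.
have := leq_mul b1 b2; rewrite mulnDr -!mulnn.
move: (L * expr_size e1) (L * expr_size e2) => u v; nia.
Qed.

(** The constant covers the dearest step, a write: two small expressions at [1200 * L ^ 2] each, an
    address of length at most [20 * L ^ 2], and constant overhead. *)
Definition unit_cost : nat := 3000 * L ^ 2.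

Lemma small_ecost s e : bounded L s -> small e -> ecost s e <= 1200 * L ^ 2.
Proof.
move=> bs /andP[sz sc]; apply: leq_trans (ecost_leq bs sc) _.
rewrite expnMn; have : expr_size e ^ 2 <= 20 ^ 2 by rewrite leq_exp2r.
move: (L ^ 2) (expr_size e ^ 2) => u v; rewrite -[20 ^ 2]/400; nia.
Qed.

Lemma small_bitlen s e : bounded L s -> small e -> bitlen (eval s e) <= 20 * L ^ 2.
Proof.
move=> bs /andP[sz sc]; apply: leq_trans (bitlen_eval bs sc) _.
rewrite mulnC leq_mul //; nia.
Qed.

Lemma unit_cost_gt0 : 3000 <= unit_cost.
Proof. rewrite /unit_cost -{1}[3000]muln1 leq_mul2l expn_gt0 L_gt0; lia. Qed.

Lemma small_unit s e : bounded L s -> small e -> (ecost s e).+1 <= unit_cost.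
Proof.
move=> bs se; have := small_ecost bs se; have := unit_cost_gt0.
rewrite /unit_cost; move: (L ^ 2) => u; lia.
Qed.
End Cost.

(** * Frame conditions and rules for counting steps *)

Fixpoint mod_reg (c : com) : seq nat :=
  match c with
  | Skip | Write _ _ _ => [::]
  | Assign x _ => [:: x]
  | Seq c1 c2 | If _ c1 c2 => mod_reg c1 ++ mod_reg c2
  | While _ c1 => mod_reg c1
  end.

Fixpoint mod_arr (c : com) : seq nat :=
  match c with
  | Skip | Assign _ _ => [::]
  | Write a _ _ => [:: a]
  | Seq c1 c2 | If _ c1 c2 => mod_arr c1 ++ mod_arr c2
  | While _ c1 => mod_arr c1
  end.

Definition frame (xs aa : seq nat) (s s' : state) : Prop :=
  (forall x, x \notin xs -> reg s' x = reg s x) /\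
  (forall a i, a \notin aa -> arr s' a i = arr s a i).

Lemma frame_trans xs aa s1 s2 s3 :
  frame xs aa s1 s2 -> frame xs aa s2 s3 -> frame xs aa s1 s3.
Proof.
move=> [r12 a12] [r23 a23]; split=> [x xN|a i aN].
  by rewrite r23 ?r12.
by rewrite a23 ?a12.
Qed.

Lemma frame_sub xs aa xs' aa' s s' :
  {subset xs <= xs'} -> {subset aa <= aa'} ->
  frame xs aa s s' -> frame xs' aa' s s'.
Proof.
move=> sx sa [r a]; split=> [x xN|b i bN].
  by apply: r; apply: contra xN; apply: sx.
by apply: a; apply: contra bN; apply: sa.
Qed.

Lemma exec_frame c s t s' :
  exec c s t s' -> frame (mod_reg c) (mod_arr c) s s'.
Proof.
elim=> {c s t s'} //=.
- move=> x e s; split=> //= y; by rewrite inE => /negbTE->.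
- move=> a e1 e2 s; split=> //= b i; by rewrite inE => /negbTE->.
- move=> c1 c2 s t1 s1 t2 s2 _ f1 _ f2.
  apply: (frame_trans (s2 := s1)).
    by apply: frame_sub f1 => x; rewrite mem_cat => ->.
  by apply: frame_sub f2 => x; rewrite mem_cat orbC => ->.
- move=> e c1 c2 s t s1 _; case: ifP => _; apply: frame_sub => x.
  + by rewrite mem_cat => ->.
  + by rewrite mem_cat => ->.
  + by rewrite mem_cat orbC => ->.
  by rewrite mem_cat orbC => ->.
- by move=> e c s t1 s1 t2 s2 _ _ f1 _; apply: frame_trans.
Qed.

Definition For (x : nat) (e : expr) (c : com) : com :=
  Seq (Assign x (Const 0))
      (While (Bin Defs.Sub e (Reg x)) (Seq c (Assign x (Bin Add (Reg x) (Const 1))))).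

(* [runs] is a total-correctness triple; [N] counts steps, each of which is    *)
(* charged [unit_cost L] as long as all stored numbers have at most [L] bits. *)
Section Runs.
Variable L : nat.
Hypothesis L_gt0 : 0 < L.
Local Notation K := (unit_cost L).

Definition runs (c : com) (s : state) (N : nat) (Q : state -> Prop) : Prop :=
  bounded L s -> exists t s',
    [/\ exec c s t s', t <= N * K, bounded L s',
        frame (mod_reg c) (mod_arr c) s s' & Q s'].

Lemma runs_weaken c s N N' (Q Q' : state -> Prop) :
  N <= N' ->
  (forall s', frame (mod_reg c) (mod_arr c) s s' -> Q s' -> Q' s') ->
  runs c s N Q -> runs c s N' Q'.
Proof.
move=> NN' QQ' r bs; have [t [s' [ex tN bs' fr Qs']]] := r bs.
exists t, s'; split=> //; last exact: QQ'.
by apply: leq_trans tN _; rewrite leq_mul2r NN' orbT.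
Qed.

Lemma runs_leq N c s N' (Q : state -> Prop) :
  N <= N' -> runs c s N Q -> runs c s N' Q.
Proof. by move=> NN'; apply: runs_weaken NN' _. Qed.

Lemma runs_skip s (Q : state -> Prop) : Q s -> runs Skip s 1 Q.
Proof.
move=> Qs bs; exists 1, s; split=> //; first exact: ExecSkip.
by rewrite mul1n; apply: leq_trans (unit_cost_gt0 L_gt0).
Qed.

(** Asking for a value below [L] rather than [2 ^ L] suffices, since everything the program stores
    is numerically polynomial; only the numerator and denominator in the input may need all [L]
    bits. *)
Lemma runs_assign x e s (Q : state -> Prop) :
  small e -> eval s e < L -> Q (set_reg s x (eval s e)) ->
  runs (Assign x e) s 1 Q.
Proof.
move=> se vL Qs bs; have ex := ExecAssign x e s.
exists (ecost s e).+1, (set_reg s x (eval s e)); split=> //.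
- by rewrite mul1n small_unit.
- by apply: bounded_set_reg => //; apply: ltn_trans vL (ltn_expl _ _).
exact: exec_frame ex.
Qed.

Lemma runs_write a e1 e2 s (Q : state -> Prop) :
  small e1 -> small e2 -> eval s e2 < L ->
  Q (set_arr s a (eval s e1) (eval s e2)) ->
  runs (Write a e1 e2) s 1 Q.
Proof.
move=> s1 s2 vL Qs bs; have ex := ExecWrite a e1 e2 s.
exists (ecost s e1 + bitlen (eval s e1) + ecost s e2).+1,
       (set_arr s a (eval s e1) (eval s e2)); split=> //.
- have := small_ecost L_gt0 bs s1; have := small_ecost L_gt0 bs s2.
  have := small_bitlen L_gt0 bs s1; have := unit_cost_gt0 L_gt0.
  by rewrite mul1n /unit_cost; move: (L ^ 2) => u; lia.
- by apply: bounded_set_arr => //; apply: ltn_trans vL (ltn_expl _ _).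
exact: exec_frame ex.
Qed.

Lemma runs_seq N1 N2 c1 c2 s N (Q : state -> Prop) :
  (N1 + N2).+1 <= N ->
  runs c1 s N1 (fun s' => runs c2 s' N2 Q) ->
  runs (Seq c1 c2) s N Q.
Proof.
move=> leN r1; apply: runs_leq leN _ => bs.
have [t1 [s1 [e1 tN1 b1 _ r2]]] := r1 bs.
have [t2 [s2 [e2 tN2 b2 _ Q2]]] := r2 b1.
have ex := ExecSeq e1 e2.
exists (t1 + t2).+1, s2; split=> //; last exact: exec_frame ex.
by have := unit_cost_gt0 L_gt0; rewrite mulSn mulnDl; lia.
Qed.

Lemma runs_if e c1 c2 s N (Q : state -> Prop) :
  small e -> runs (if eval s e != 0 then c1 else c2) s N Q ->
  runs (If e c1 c2) s N.+1 Q.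
Proof.
move=> se r bs; have [t1 [s1 [e1 tN1 b1 _ Q1]]] := r bs.
have ex := ExecIf e1.
exists (ecost s e + t1).+1, s1; split=> //; last exact: exec_frame ex.
by have := small_unit L_gt0 bs se; rewrite mulSn; lia.
Qed.

Lemma runs_while_false e c s (Q : state -> Prop) :
  small e -> eval s e = 0 -> Q s -> runs (While e c) s 1 Q.
Proof.
move=> se e0 Qs bs; have ex := ExecWhileFalse c e0.
exists (ecost s e).+1, s; split=> //.
by rewrite mul1n small_unit.
Qed.

Lemma runs_while_true e c s N1 N2 (Q : state -> Prop) :
  small e -> eval s e != 0 ->
  runs c s N1 (fun s' => runs (While e c) s' N2 Q) ->
  runs (While e c) s (N1 + N2).+1 Q.
Proof.
move=> se e1 r1 bs; have [t1 [s1 [x1 tN1 b1 _ r2]]] := r1 bs.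
have [t2 [s2 [x2 tN2 b2 _ Q2]]] := r2 b1.
have ex := ExecWhileTrue e1 x1 x2.
exists (ecost s e + t1 + t2).+1, s2; split=> //; last exact: exec_frame ex.
by have := small_unit L_gt0 bs se; rewrite mulSn mulnDl; lia.
Qed.

(** The [3] per round pays for the loop test, the sequencing and the increment. The bound [e] must
    keep its value under any change to what the loop can modify. *)
Lemma runs_for x e c s m N (I : nat -> state -> Prop) (Q : state -> Prop) :
  small (Bin Defs.Sub e (Reg x)) -> m < L -> x \notin mod_reg c ->
  (forall s', frame (x :: mod_reg c) (mod_arr c) s s' -> eval s' e = m) ->
  I 0 (set_reg s x 0) ->
  (forall i s', i < m -> reg s' x = i ->
     frame (x :: mod_reg c) (mod_arr c) s s' -> I i s' ->
     runs c s' N (fun s'' => I i.+1 (set_reg s'' x i.+1))) ->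
  (forall s', reg s' x = m -> frame (x :: mod_reg c) (mod_arr c) s s' ->
     I m s' -> Q s') ->
  runs (For x e c) s (m * (N + 3) + 3) Q.
Proof.
move=> se mL xc em I0 step post.
pose Fr := frame (x :: mod_reg c) (mod_arr c) s.
have fr_set s' v : Fr s' -> Fr (set_reg s' x v).
  case=> fr fa; split=> //= y; rewrite inE negb_or => /andP[yx yN].
  by rewrite (negbTE yx) fr // inE negb_or yx.
have loop : forall k s', k <= m -> reg s' x = m - k -> Fr s' -> I (m - k) s' ->
    runs (While (Bin Defs.Sub e (Reg x))
           (Seq c (Assign x (Bin Add (Reg x) (Const 1))))) s' (k * (N + 3) + 1) Q.
  elim=> [|k IHk] s' km rx frs Is.
    rewrite subn0 in rx Is; apply: runs_while_false => //=; last exact: post.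
    by rewrite em // rx subnn.
  have lt_m : m - k.+1 < m by lia.
  have -> : k.+1 * (N + 3) + 1 = ((N + 1).+1 + (k * (N + 3) + 1)).+1 by nia.
  apply: runs_while_true => //=; first by rewrite em // rx; lia.
  apply: runs_seq (leqnn _) _; apply: runs_weaken (step _ _ lt_m rx frs Is) => // s1 fr1 I1.
  have r1 : reg s1 x = m - k.+1 by rewrite fr1.1 // rx.
  have e1 : m - k.+1 + 1 = m - k by lia.
  have f1 : Fr s1.
    apply: frame_trans frs _; apply: frame_sub fr1 => // y.
    by rewrite inE orbC => ->.
  apply: runs_assign => //=; rewrite r1 e1; first by lia.
  apply: IHk; [lia| by rewrite /= eqxx | exact: fr_set |].
  by have -> : m - k = (m - k.+1).+1 by lia.
apply: (runs_seq (N1 := 1) (N2 := m * (N + 3) + 1)); first by lia.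
apply: runs_assign => //=.
by apply: loop => //=; rewrite ?subnn ?eqxx //; apply: fr_set.
Qed.

End Runs.

(** * Greedy phase and exhaustive search *)

Local Notation "a [+] b" := (Bin Add a b) (at level 50, left associativity).
Local Notation "a [-] b" := (Bin Defs.Sub a b) (at level 50, left associativity).
Local Notation "a [*] b" := (Bin Mul a b) (at level 40, left associativity).
Local Notation "a [/] b" := (Bin Div a b) (at level 40, left associativity).
Local Notation "c1 ;; c2" := (Seq c1 c2) (at level 60, right associativity).
Local Notation "x <~ e" := (Assign x e) (at level 55).

Local Notation rn := (Reg 0).
Local Notation rd := (Reg 1).
Local Notation one := (Const 1).

(* Registers: 4 holds the radius [h], 5 the threshold for small balls, 6 the  *)
(* maximal stack height, 7 the current vertex, 10 the stack height, 13 the    *)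
(* height of the greedy part of the stack, 14 the size of the best set.       *)
(* Arrays: 2 holds the layers of the distance matrix, 3 the stack.            *)
Definition compat_com : com :=
  11 <~ one ;;
  For 12 (Reg 10)
    (If (Read 2 (((rd [-] one) [*] rn [+] Read 3 (Reg 12)) [*] rn [+] Reg 7))
       (11 <~ Const 0) Skip).

Definition ball_com : com :=
  8 <~ Const 0 ;;
  For 12 rn
    (If (Read 2 ((Reg 4 [*] rn [+] Reg 7) [*] rn [+] Reg 12))
       (8 <~ Reg 8 [+] one) Skip).

Definition push_com : com :=
  Write 3 (Reg 10) (Reg 7) ;; 10 <~ Reg 10 [+] one.

Definition greedy_com : com :=
  10 <~ Const 0 ;;
  For 7 rn
    (compat_com ;; ball_com ;;
     If (Reg 11 [*] (Reg 5 [+] one [-] Reg 8)) push_com Skip).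

Definition record_com : com :=
  If (Reg 10 [-] Reg 14)
    (14 <~ Reg 10 ;;
     For 12 rn (Write 1 (Reg 12) (Const 0)) ;;
     For 12 (Reg 10) (Write 1 (Read 3 (Reg 12)) one))
    Skip.

Definition search_body : com :=
  If ((rn [-] Reg 7) [*] (Reg 6 [-] Reg 10))
    (compat_com ;;
     If (Reg 11) (push_com ;; record_com) Skip ;;
     7 <~ Reg 7 [+] one)
    (If (Reg 10 [-] Reg 13)
       (10 <~ Reg 10 [-] one ;; 7 <~ Read 3 (Reg 10) [+] one)
       (15 <~ Const 0)).

Definition search_loop : com := While (Reg 15) search_body.

Definition search_com : com :=
  13 <~ Reg 10 ;; 6 <~ Reg 6 [+] Reg 10 ;; 7 <~ Const 0 ;; 15 <~ one ;;
  record_com ;; search_loop.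

(** Bounds the loop iterations for [m] remaining candidates and room for [j] more vertices: take the
    candidate, skip it, and [2] for its test and its later removal from the stack. *)
Fixpoint visits (m j : nat) : nat :=
  match m, j with
  | m'.+1, j'.+1 => visits m' j' + visits m' j + 2
  | _, _ => 0
  end.

(** * Verification of the greedy phase and of the depth-first search *)

Section Search.
Variables (L n d h thr : nat) (cl nb : rel nat).
Hypothesis L_large : 4 * n + thr + 4 < L.
Hypothesis cl_refl : forall u, u < n -> cl u u.

Let L_gt0 : 0 < L. Proof. lia. Qed.

Local Notation runs := (runs L).

Definition tables (s : state) : Prop :=
  [/\ reg s 0 = n, reg s 1 = d, reg s 4 = h & reg s 5 = thr] /\
  (forall u v, u < n -> v < n ->
     (arr s 2 (((d - 1) * n + u) * n + v) != 0) = cl u v /\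
     (arr s 2 ((h * n + u) * n + v) != 0) = nb u v).

Definition stack (s : state) (st : seq nat) : Prop :=
  reg s 10 = size st /\ (forall i, i < size st -> arr s 3 i = nth 0 st i).

Definition best (s : state) (o : seq nat) : Prop :=
  reg s 14 = size o /\ (forall v, v < n -> (arr s 1 v != 0) = (v \in o)).

Definition packing (st : seq nat) : bool :=
  all (fun v => v < n) st && pairwise (fun u v => ~~ cl u v) st.

Lemma tables_frame xs aa s s' :
  frame xs aa s s' -> all (fun x => x \notin xs) [:: 0; 1; 4; 5] ->
  2 \notin aa -> tables s -> tables s'.
Proof.
move=> [fr fa] /and5P[x0 x1 x4 x5 _] a2 [[r0 r1 r4 r5] D].
split; first by rewrite !fr.
by move=> u v un vn; rewrite !fa //; apply: D.
Qed.

Lemma stack_frame xs aa s s' st :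
  frame xs aa s s' -> 10 \notin xs -> 3 \notin aa ->
  stack s st -> stack s' st.
Proof.
move=> [fr fa] x10 a3 [t c]; split; first by rewrite fr.
by move=> i ist; rewrite fa ?c.
Qed.

Lemma best_frame xs aa s s' o :
  frame xs aa s s' -> 14 \notin xs -> 1 \notin aa ->
  best s o -> best s' o.
Proof.
move=> [fr fa] x10 a3 [t c]; split; first by rewrite fr.
by move=> i ist; rewrite fa ?c.
Qed.

Lemma runs_compat s st x :
  tables s -> stack s st -> reg s 7 = x -> x < n -> all (fun v => v < n) st ->
  size st <= 2 * n + 1 ->
  runs compat_com s (5 * size st + 5)
    (fun s' => (reg s' 11 != 0) = all (fun y => ~~ cl y x) st).
Proof.
move=> tb [t c] r7 xn stn szst.
apply: (runs_seq (N1 := 1) (N2 := size st * (2 + 3) + 3) L_gt0); first by lia.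
apply: runs_assign => //=; first by lia.
apply: (runs_for (m := size st) (I := fun i s' =>
  (reg s' 11 != 0) = all (fun y => ~~ cl y x) (take i st)) L_gt0) => //.
- by lia.
- by move=> s' fr /=; rewrite (fr.1 10 isT).
- by rewrite take0.
- move=> i s' ilt ri fr Ii; apply: runs_if => //.
  have [[r0 r1 r4 r5] D] := tb.
  have nthn : nth 0 st i < n by apply: (allP stn); rewrite mem_nth.
  have -> : (eval s' (Read 2
      (((rd [-] one) [*] rn [+] Read 3 (Reg 12)) [*] rn [+] Reg 7)) != 0) = cl (nth 0 st i) x.
    rewrite /= ri !fr.2 //= !fr.1 //= r0 r1 r7 c //.
    by case: (D (nth 0 st i) x nthn xn).
  rewrite (take_nth 0 ilt) -cats1 all_cat /= andbT.
  case: ifP => cx.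
    by apply: runs_assign => //=; rewrite andbF.
  by apply: runs_skip => //=; rewrite andbT.
by move=> s' _ _; rewrite take_size.
Qed.

Lemma runs_ball s x :
  tables s -> reg s 7 = x -> x < n ->
  runs ball_com s (5 * n + 5) (fun s' => reg s' 8 = count (nb x) (iota 0 n)).
Proof.
move=> tb r7 xn; have [[r0 r1 r4 r5] D] := tb.
apply: (runs_seq (N1 := 1) (N2 := n * (2 + 3) + 3) L_gt0); first by lia.
apply: runs_assign => //=.
apply: (runs_for (m := n) (I := fun i s' =>
  reg s' 8 = count (nb x) (iota 0 i)) L_gt0) => //.
- by lia.
- by move=> s' fr /=; rewrite (fr.1 0 isT).
move=> i s' ilt ri fr Ii; apply: runs_if => //.
have -> : (eval s' (Read 2 ((Reg 4 [*] rn [+] Reg 7) [*] rn [+] Reg 12)) != 0)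
     = nb x i.
  rewrite /= ri !fr.2 //= !fr.1 //= r0 r4 r7.
  by case: (D x i xn ilt).
rewrite -(addn1 i) iotaD count_cat /= addn0 add0n.
have := count_size (nb x) (iota 0 i); rewrite size_iota => cs.
case: ifP => cx.
  apply: runs_assign => //=; rewrite Ii; [lia | by rewrite addn1].
by apply: runs_skip => //=; rewrite Ii addn0.
Qed.

Lemma runs_push s st x :
  stack s st -> reg s 7 = x -> x < n -> size st < 2 * n + 1 ->
  runs push_com s 3 (fun s' => stack s' (rcons st x)).
Proof.
move=> [t c] r7 xn sz; apply: (runs_seq (N1 := 1) (N2 := 1) L_gt0) => //.
apply: runs_write => //=; first by lia.
apply: runs_assign => //=; rewrite t; first by lia.
split; rewrite /= ?size_rcons ?addn1 // => i; rewrite ltnS leq_eqVlt.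
rewrite nth_rcons r7; case: eqP => [->|_] /= ilt; first by rewrite ltnn.
by rewrite ilt c.
Qed.

Lemma packing_rcons st x :
  packing (rcons st x) =
  [&& packing st, x < n & all (fun y => ~~ cl y x) st].
Proof.
rewrite /packing -cats1 all_cat pairwise_cat /= !andbT allrel1r.
by case: all; case: pairwise; case: ltnP; case: all.
Qed.

Lemma packing_uniq st : packing st -> uniq st.
Proof.
case/andP=> stn pw; move: stn pw.
elim: st => //= x st IH /andP[xn stn] /andP[xst pw]; rewrite IH // andbT.
by apply/negP=> xin; have := allP xst x xin; rewrite cl_refl.
Qed.

Lemma packing_size st : packing st -> size st <= n.
Proof.
move=> pk; rewrite -(size_iota 0 n); apply: uniq_leq_size.
  exact: packing_uniq pk.
by move=> x xst; rewrite mem_iota add0n; case/andP: pk => /allP/(_ x xst).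
Qed.

Definition small_ball x := count (nb x) (iota 0 n) <= thr.

(** A vertex with a small ball is left out only because it is too close to one kept earlier, which
    gives the maximality in the last clause. *)
Lemma runs_greedy s :
  tables s -> runs greedy_com s (20 * (n + 1) ^ 2)
    (fun s' => exists st, [/\ stack s' st, packing st, all small_ball st
       & forall y, y < n -> small_ball y -> has (cl ^~ y) st]).
Proof.
move=> tb; apply: (runs_seq (N1 := 1) (N2 := n * (10 * n + 16 + 3) + 3) L_gt0).
  by rewrite -mulnn; nia.
apply: runs_assign => //=.
apply: (runs_for (m := n) (I := fun i s' =>
  exists st, [/\ stack s' st, packing st, all small_ball st
       & forall y, y < i -> small_ball y -> has (cl ^~ y) st]) L_gt0) => //.
- by lia.
- by case: tb => -[r0 _ _ _] _ s' fr /=; rewrite (fr.1 0 isT).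
- by exists [::].
move=> i s' ilt ri fr [st [Sst pst sst ist]].
have tb' : tables s' by apply: tables_frame fr _ _ _.
have szst := packing_size pst.
apply: (runs_seq (N1 := 5 * size st + 5) (N2 := 5 * n + 10) L_gt0); first by lia.
have stn : all (fun v => v < n) st by case/andP: pst.
apply: runs_weaken (runs_compat tb' Sst ri ilt stn _) => //; last by lia.
move=> s1 fr1 ok1.
have tb1 : tables s1 by apply: tables_frame fr1 _ _ _.
have ri1 : reg s1 7 = i by rewrite (fr1.1 7 isT).
have Sst1 : stack s1 st by apply: stack_frame fr1 _ _ _.
apply: (runs_seq (N1 := 5 * n + 5) (N2 := 4) L_gt0); first by lia.
apply: runs_weaken (runs_ball tb1 ri1 ilt) => // s2 fr2 b2.
have tb2 : tables s2 by apply: tables_frame fr2 _ _ _.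
have ri2 : reg s2 7 = i by rewrite (fr2.1 7 isT).
have Sst2 : stack s2 st by apply: stack_frame fr2 _ _ _.
have ok2 : (reg s2 11 != 0) = all (fun y => ~~ cl y i) st.
  by rewrite (fr2.1 11 isT).
apply: runs_if => //.
have -> : (eval s2 (Reg 11 [*] (Reg 5 [+] one [-] Reg 8)) != 0)
   = all (fun y => ~~ cl y i) st && small_ball i.
  have [[_ _ _ r5] _] := tb2.
  rewrite /= muln_eq0 negb_or ok2 r5 b2 /small_ball; congr andb; lia.
case: ifP => [/andP[compi smi]|notboth].
  apply: runs_weaken (runs_push Sst2 ri2 ilt _) => //; last by lia.
  move=> s3 fr3 Sst3; exists (rcons st i); split.
  - exact: Sst3.
  - by rewrite packing_rcons pst ilt.
  - by rewrite all_rcons smi.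
  move=> y; rewrite ltnS leq_eqVlt => /orP[/eqP->|yi] smy.
    by rewrite has_rcons cl_refl.
  by rewrite has_rcons ist ?orbT.
apply: runs_weaken (_ : runs Skip s2 1 (fun s' => s' = s2)) => //.
  move=> s3 _ ->; exists st; split=> // y.
  rewrite ltnS leq_eqVlt => /orP[/eqP->|yi] smy; last exact: ist.
  by move: notboth; rewrite smy andbT => /negbT/allPn[z zst /negPn clz];
     apply/hasP; exists z.
exact: runs_skip.
Qed.

Lemma runs_record s st o :
  tables s -> stack s st -> packing st -> best s o ->
  runs record_com s (8 * n + 10) (fun s' => exists o',
    [/\ best s' o', o' = o \/ o' = st, size o <= size o' & size st <= size o']).
Proof.
move=> tb Sst pst [b bo]; have [[r0 _ _ _] _] := tb; have [t c] := Sst.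
have sz := packing_size pst; have stn : all (fun v => v < n) st by case/andP: pst.
apply: (runs_leq (N := (8 * n + 9).+1)); first by lia.
apply: runs_if => //=; rewrite t b; case: ifP => lt.
  apply: (runs_seq (N1 := 1) (N2 := 8 * n + 7) L_gt0); first by lia.
  apply: runs_assign => //=; first by lia.
  apply: (runs_seq (N1 := n * (1 + 3) + 3) (N2 := size st * (1 + 3) + 3) L_gt0).
    by lia.
  apply: (runs_for (m := n) (I := fun i s' =>
    forall v, v < i -> arr s' 1 v = 0) L_gt0) => //.
  - by lia.
  - by move=> s' fr /=; rewrite (fr.1 0 isT).
  - move=> i s' ilt ri fr Ii; apply: runs_write => //= v.
    by rewrite ri; case: eqP => //= vi vlt; apply: Ii; lia.
  move=> s1 _ fr1 I1.
  apply: (runs_for (m := size st) (I := fun i s' => forall v, v < n ->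
    (arr s' 1 v != 0) = (v \in take i st)) L_gt0) => //.
  - by lia.
  - by move=> s' fr /=; rewrite (fr.1 10 isT) (fr1.1 10 isT).
  - by move=> v vn /=; rewrite I1 // take0.
  - move=> i s' ilt ri fr Ii; apply: runs_write => //=; first by lia.
    move=> v vn; rewrite ri (fr.2 3 i isT) (fr1.2 3 i isT) /= c //.
    rewrite (take_nth 0 ilt) mem_rcons inE.
    by case: (v == nth 0 st i) => //=; apply: Ii.
  move=> s2 _ fr2 I2; exists st; split=> //; [|by right|lia].
  split; last by move=> v vn; rewrite I2 // take_size.
  by rewrite (fr2.1 14 isT) (fr1.1 14 isT) /=.
apply: runs_weaken (_ : runs Skip s 1 (fun s' => s' = s)) => //.
- by lia.
- by move=> s1 _ ->; exists o; split=> //; [left | lia].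
exact: runs_skip.
Qed.

Variables lim t0 : nat.
Hypothesis lim_le : lim <= 2 * n + 1.

Definition search_inv (s : state) (st : seq nat) (x : nat) (o : seq nat) : Prop :=
  [/\ tables s, [/\ reg s 6 = lim, reg s 13 = t0, reg s 15 = 1 & reg s 7 = x],
      [/\ stack s st, packing st & t0 <= size st],
      [/\ best s o, packing o & size st <= size o] & x <= n].

(** Increasing lists suffice, because a set has just one increasing listing and the search pushes
    vertices in that order. *)
Definition covers (st : seq nat) (x j : nat) (o : seq nat) : Prop :=
  forall Z, sorted ltn Z -> all (fun z => x <= z) Z -> size Z <= j ->
    packing (st ++ Z) -> size st + size Z <= size o.

Lemma covers0 st x j o : (n <= x) || (j == 0) -> size st <= size o ->
  covers st x j o.
Proof.
move=> xj szo [|z Z] _ /=; rewrite ?addn0 // => /andP[xz _] szj.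
case/orP: xj => [nx|/eqP j0]; last by rewrite j0 in szj.
by rewrite /packing all_cat /= => /andP[/and3P[_ zn _] _]; lia.
Qed.

Lemma covers_skip st x j o :
  ~~ all (fun y => ~~ cl y x) st -> covers st x.+1 j o -> covers st x j o.
Proof.
move=> ncomp cov [|z Z] sZ /= xZ szj pk; first exact: (cov [::]).
have [zx|zx] := eqVneq z x.
  rewrite zx -cat_rcons in pk; case/negP: ncomp.
  case/andP: pk => _; rewrite pairwise_cat => /and3P[_ + _].
  by rewrite -cats1 pairwise_cat allrel1r => /and3P[].
apply: (cov (z :: Z)) => //; apply/allP=> y; rewrite inE => /orP[/eqP->|yZ].
  by case/andP: xZ; lia.
have := order_path_min ltn_trans sZ => /allP/(_ y yZ); case/andP: xZ; lia.
Qed.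

(** An extension with candidates from [x] on either starts with [x], and was met below [rcons st x],
    or has all its elements beyond [x]. *)
Lemma covers_push st x j o o' :
  size o <= size o' -> covers (rcons st x) x.+1 j o -> covers st x.+1 j.+1 o' ->
  covers st x j.+1 o'.
Proof.
move=> oo' cov1 cov2 [|z Z] sZ /= xZ szj pk; first exact: (cov2 [::]).
have gtz := order_path_min ltn_trans sZ.
have [zx|zx] := eqVneq z x.
  rewrite zx -cat_rcons in pk; apply: leq_trans oo'.
  have := cov1 Z; rewrite size_rcons addSnnS; apply=> //.
    exact: path_sorted sZ.
  by rewrite -zx.
apply: (cov2 (z :: Z)) => //; apply/allP=> y; rewrite inE => /orP[/eqP->|yZ].
  by case/andP: xZ; lia.
by have := allP gtz y yZ; case/andP: xZ; lia.
Qed.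

Definition iter_steps := 40 * n + 50.

(* Continuation-passing form of the recursive enumeration: once every          *)
(* extension of [st] by at most [j] vertices [>= x] is explored, the loop      *)
(* stands again at the stack [st].                                             *)
Lemma search_explore (Q : state -> Prop) m : forall j x st o s N,
  n - x = m -> size st + j = lim -> search_inv s st x o ->
  (forall s' o' x', search_inv s' st x' o' -> (n <= x') || (j == 0) ->
     size o <= size o' -> covers st x j o' -> runs search_loop s' N Q) ->
  runs search_loop s (visits m j * iter_steps + N) Q.
Proof.
elim: m => [|m IH] j x st o s N nx szj inv cont.
  have [_ _ _ [_ _ szo] xn] := inv.
  have nlex : (n <= x) || (j == 0) by lia.
  by rewrite mul0n; apply: cont inv _ _ _ => //; apply: covers0.
case: j szj cont => [|j] szj cont.
  have [_ _ _ [_ _ szo] xn] := inv.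
  by rewrite mul0n; apply: cont inv _ _ _; rewrite ?orbT //;
     apply: covers0; rewrite ?orbT.
have [tb [r6 r13 r15 r7] [Sst pst t0st] [bo po szo] xn] := inv.
have [[r0 _ _ _] _] := tb; have [r10 _] := Sst.
have stn : all (fun v => v < n) st by case/andP: pst.
have lt_xn : x < n by lia.
have szn := packing_size pst.
rewrite [visits _ _]/=; set N1 := visits m j; set N2 := visits m j.+1.
(* One [iter_steps] pays for testing [x] now, the other for popping it once the extensions of
   [rcons st x] are explored. *)
apply: (runs_leq (N :=
  (iter_steps - 1 + (N2 * iter_steps + N + N1 * iter_steps + iter_steps)).+1)).
  by rewrite /iter_steps; nia.
apply: runs_while_true => //=; first by rewrite r15.
apply: (runs_leq (N := ((iter_steps - 2).+1))); first by rewrite /iter_steps; lia.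
apply: runs_if => //; rewrite /= r0 r7 r6 r10.
have -> : (n - x) * (lim - size st) != 0 by rewrite muln_eq0; lia.
apply: (runs_seq (N1 := 5 * size st + 5) (N2 := 10 * n + 20) L_gt0).
  by rewrite /iter_steps; lia.
apply: runs_weaken (runs_compat tb Sst r7 lt_xn stn _) => //; last by lia.
move=> s1 fr1 ok1.
have tb1 : tables s1 by apply: tables_frame fr1 _ _ _.
have Sst1 : stack s1 st by apply: stack_frame fr1 _ _ _.
have bo1 : best s1 o by apply: best_frame fr1 _ _ _.
have [r6' r13' r15' r7'] :
    [/\ reg s1 6 = lim, reg s1 13 = t0, reg s1 15 = 1 & reg s1 7 = x].
  by rewrite !fr1.1.
apply: (runs_seq (N1 := 8 * n + 15) (N2 := 1) L_gt0); first by lia.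
apply: (runs_leq (N := ((8 * n + 14).+1))); first by lia.
apply: runs_if => //=; rewrite ok1; case: ifP => comp.
  have pst' : packing (rcons st x) by rewrite packing_rcons pst lt_xn.
  apply: (runs_seq (N1 := 3) (N2 := 8 * n + 10) L_gt0); first by lia.
  apply: runs_weaken (runs_push Sst1 r7' lt_xn _) => //; last by lia.
  move=> s2 fr2 Sst2.
  have tb2 : tables s2 by apply: tables_frame fr2 _ _ _.
  have bo2 : best s2 o by apply: best_frame fr2 _ _ _.
  apply: runs_weaken (runs_record tb2 Sst2 pst' bo2) => //.
  move=> s3 fr3 [o3 [bo3 o3or szo3 szst3]].
  have tb3 : tables s3 by apply: tables_frame fr3 _ _ _.
  have Sst3 : stack s3 (rcons st x) by apply: stack_frame fr3 _ _ _.
  have po3 : packing o3 by case: o3or => ->.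
  have [r6_3 r13_3 r15_3 r7_3] :
      [/\ reg s3 6 = lim, reg s3 13 = t0, reg s3 15 = 1 & reg s3 7 = x].
    by rewrite !fr3.1 // !fr2.1.
  apply: runs_assign => //=; rewrite r7_3 addn1; first by lia.
  apply: (runs_leq (N := (N1 * iter_steps + (iter_steps + (N2 * iter_steps + N))))).
    by lia.
  apply: (IH j x.+1 (rcons st x) o3) => //; [lia | by rewrite size_rcons; lia | |].
    split=> //; split=> //.
    by rewrite size_rcons; lia.
  move=> s4 o4 x4 [tb4 [r6_4 r13_4 r15_4 r7_4] [Sst4 _ _] [bo4 po4 szo4] xn4].
  move=> end4 szo34 cov4.
  have [[r0_4 _ _ _] _] := tb4; have [r10_4 c4] := Sst4.
  rewrite size_rcons in r10_4 c4 szo4.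
  apply: (runs_leq (N := (((iter_steps - 1) + (N2 * iter_steps + N)).+1))).
    by rewrite /iter_steps; lia.
  (* By [end4] nothing more can be pushed onto [rcons st x], so this iteration pops; the popped cell
     still holds [x], whence the next candidate [x.+1]. *)
  apply: runs_while_true => //=; first by rewrite r15_4.
  apply: (runs_leq (N := 4.+1)); first by rewrite /iter_steps; lia.
  apply: runs_if => //=; rewrite r0_4 r7_4 r6_4 r10_4.
  have -> : ((n - x4) * (lim - (size st).+1) != 0) = false.
    apply/negbTE/negPn; rewrite muln_eq0 !subn_eq0; case/orP: end4 => [->//|j0].
    by rewrite orbC; lia.
  apply: runs_if => //=; rewrite r10_4 r13_4.
  have -> : (size st).+1 - t0 != 0 by lia.
  apply: (runs_seq (N1 := 1) (N2 := 1) L_gt0) => //.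
  apply: runs_assign => //=; first by rewrite r10_4; lia.
  rewrite r10_4 subn1 /=.
  have nthx : arr s4 3 (size st) = x by rewrite c4 // nth_rcons ltnn eqxx.
  apply: runs_assign => //=; rewrite nthx addn1; first by lia.
  apply: (IH j.+1 x.+1 st o4) => //; first by lia.
    split=> //; last by split=> //; lia.
    split=> //; split=> //= i ilt.
    by rewrite c4 1?ltnW // nth_rcons ilt.
  move=> s5 o5 x5 inv5 end5 szo45 cov5.
  apply: cont inv5 _ _ _ => //; first by lia.
  by apply: covers_push szo45 cov4 cov5.
apply: runs_weaken (_ : runs Skip s1 1 (fun s' => s' = s1)) => //.
- by lia.
- move=> s2 _ ->.
  apply: runs_assign => //=; rewrite r7' addn1; first by lia.
  apply: (runs_leq (N := (N2 * iter_steps + N))); first by lia.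
  apply: (IH j.+1 x.+1 st o) => //; first by lia.
  move=> s5 o5 x5 inv5 end5 szo45 cov5.
  apply: cont inv5 _ _ _ => //.
  by apply: covers_skip cov5; rewrite comp.
exact: runs_skip.
Qed.
End Search.

Lemma runs_search (L n d h thr k : nat) (cl nb : rel nat) s st :
  4 * n + thr + 4 < L -> (forall u, u < n -> cl u u) -> k <= n + 1 ->
  tables n d h thr cl nb s -> stack s st -> packing n cl st ->
  best n s [::] -> reg s 6 = k ->
  runs L search_com s (visits n k * iter_steps n + (8 * n + 40)) (fun s' =>
    exists o, [/\ best n s' o, packing n cl o & covers n cl st 0 k o]).
Proof.
move=> LL clr kn tb Sst pst bo r6; have L_gt0 : 0 < L by lia.
have [r10 _] := Sst; have szn := packing_size clr pst.
set V := visits n k * iter_steps n.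
apply: (runs_seq (N1 := 1) (N2 := V + (8 * n + 38)) L_gt0); first by lia.
apply: runs_assign => //=; first by lia.
apply: (runs_seq (N1 := 1) (N2 := V + (8 * n + 36)) L_gt0); first by lia.
apply: runs_assign => //=; first by lia.
apply: (runs_seq (N1 := 1) (N2 := V + (8 * n + 34)) L_gt0); first by lia.
apply: runs_assign => //=.
apply: (runs_seq (N1 := 1) (N2 := V + (8 * n + 32)) L_gt0); first by lia.
apply: runs_assign => //=; first by lia.
apply: (runs_seq (N1 := 8 * n + 10) (N2 := V + 20) L_gt0); first by lia.
set s1 := set_reg _ 15 1.
have tb1 : tables n d h thr cl nb s1 by [].
have Sst1 : stack s1 st by exact: Sst.
have bo1 : best n s1 [::] by exact: bo.
apply: runs_weaken (runs_record LL clr tb1 Sst1 pst bo1) => //.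
move=> s2 fr2 [o2 [bo2 o2or _ szo2]].
have tb2 : tables n d h thr cl nb s2 by apply: tables_frame fr2 _ _ _.
have Sst2 : stack s2 st by apply: (stack_frame fr2).
have po2 : packing n cl o2 by case: o2or => ->.
have inv2 : search_inv n d h thr cl nb (k + size st) (size st) s2 st 0 o2.
  by split=> //; split; rewrite fr2.1 //= ?r6 ?r10.
apply: (search_explore LL clr _ (subn0 n) _ inv2).
- by lia.
- by rewrite addnC.
move=> s3 o3 x3 [tb3 [r6_3 r13_3 r15_3 r7_3] [[r10_3 _] _ _] [bo3 po3 _] xn3].
move=> end3 _ cov3.
have [[r0_3 _ _ _] _] := tb3.
(* The stack is back at its greedy height, so one last iteration clears register 15 and the loop
   test then fails. *)
apply: (runs_leq (N := (10 + 1).+1)) => //.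
apply: runs_while_true => //=; first by rewrite r15_3.
apply: (runs_leq (N := 3)) => //.
apply: runs_if => //=; rewrite r0_3 r7_3 r6_3 r10_3.
have -> : ((n - x3) * (k + size st - size st) != 0) = false.
  by apply/negbTE/negPn; rewrite addnK muln_eq0 subn_eq0.
apply: runs_if => //=; rewrite r10_3 r13_3 subnn /=.
apply: runs_assign => //=.
by apply: runs_while_false => //=; exists o3.
Qed.

(** * The distance table, layer by layer *)

Section Distances.
Variables (n : nat) (A : rel nat).

(** The disjunct [w == v] lets a walk pause, so that layer [r] is the relation of distance at most
    [r]. *)
Fixpoint nat_reach (r u v : nat) : bool :=
  if r is r'.+1
  then has (fun w => nat_reach r' u w && (A w v || (w == v))) (iota 0 n)
  else u == v.

Lemma mem_iota_ltn w : (w \in iota 0 n) = (w < n).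
Proof. by rewrite mem_iota add0n. Qed.

(* The part of layer [r] that is known after the first [i] rounds. *)
Definition partial_reach (i r u v : nat) : bool :=
  if r is r'.+1
  then has (fun w => [&& ((r' * n + u) * n + v) * n + w < i, nat_reach r' u w
                       & A w v || (w == v)]) (iota 0 n)
  else u == v.

Lemma partial_reach_full i r u v :
  u < n -> v < n -> r * n ^ 3 <= i -> partial_reach i r u v = nat_reach r u v.
Proof.
case: r => //= r un vn le_i; apply: eq_in_has => w; rewrite mem_iota_ltn => wn.
suff -> : ((r * n + u) * n + v) * n + w < i by [].
by apply: leq_trans le_i; rewrite !expnS expn0 muln1; nia.
Qed.

Lemma code_inj a a' v v' :
  v < n -> v' < n -> (a * n + v == a' * n + v') = (a == a') && (v == v').
Proof.
move=> vn v'n; have n_gt0 : 0 < n by lia.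
apply/eqP/andP=> [e|[/eqP-> /eqP->]//]; split; apply/eqP.
  by have := congr1 (divn^~ n) e; rewrite !divnMDl // !divn_small // !addn0.
by have := congr1 (modn^~ n) e; rewrite !modnMDl !modn_small.
Qed.

(** Round numbers determine their quadruple by [code_inj], so one round can affect a single cell
    only. *)
Lemma partial_reachS i r u v r0 u0 v0 w0 :
  u < n -> v < n -> u0 < n -> v0 < n -> w0 < n ->
  i = ((r0 * n + u0) * n + v0) * n + w0 ->
  partial_reach i.+1 r u v = partial_reach i r u v ||
    [&& r == r0.+1, u == u0, v == v0, nat_reach r0 u0 w0 & A w0 v0 || (w0 == v0)].
Proof.
move=> un vn u0n v0n w0n ei; case: r => [|r] /=; first by rewrite orbF.
rewrite eqSS; apply/hasP/orP.
  case=> w; rewrite mem_iota_ltn => wn /and3P[].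
  rewrite ltnS leq_eqVlt ei !code_inj // => /orP[eqs|lt] rw Aw; last first.
    by left; apply/hasP; exists w; rewrite ?mem_iota_ltn // lt rw.
  case/andP: eqs => /andP[/andP[/eqP<- /eqP<-] /eqP<-] /eqP<-.
  by right; rewrite !eqxx rw.
case=> [/hasP[w wi /and3P[lt rw Aw]]|/and5P[/eqP-> /eqP-> /eqP-> rw Aw]].
  by exists w => //; rewrite rw Aw (ltn_trans lt).
by exists w0; rewrite ?mem_iota_ltn // -ei rw Aw ltnSn.
Qed.

End Distances.

Definition diag_com : com :=
  For 7 rn (Write 0 (Reg 7 [*] rn [+] Reg 7) one ;;
            Write 2 (Reg 7 [*] rn [+] Reg 7) one).

(** A single counter encodes [((r * n + u) * n + v) * n + w], which the divisions decode. Adding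
    [n * n] to the cell of [(r, u, v)] leads to the next layer. Pauses need no test, since
    [diag_com] has filled the diagonal of the adjacency matrix. *)
Definition reach_com : com :=
  For 7 ((rd [-] one) [*] rn [*] rn [*] rn)
    (8 <~ Reg 7 [/] rn ;;
     9 <~ Reg 7 [-] Reg 8 [*] rn ;;
     If (Read 2 (Reg 8 [/] rn [*] rn [+] Reg 9) [*]
         Read 0 (Reg 9 [*] rn [+] (Reg 8 [-] Reg 8 [/] rn [*] rn)))
       (Write 2 (Reg 8 [+] rn [*] rn) one) Skip).

Section DistanceTables.
Variables (L n d M : nat) (A : rel nat).
Hypothesis n_gt0 : 0 < n.
Hypothesis M_def : M = (d - 1) * n ^ 3.
Hypothesis L_large : M + n + 2 < L.

Let L_gt0 : 0 < L. Proof. lia. Qed.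

Local Notation runs := (runs L).

Lemma runs_diag s :
  reg s 0 = n ->
  (forall u v, u < n -> v < n -> (arr s 0 (u * n + v) != 0) = A u v) ->
  (forall i, arr s 2 i = 0) ->
  runs diag_com s (6 * n + 3) (fun s' =>
    (forall u v, u < n -> v < n ->
       (arr s' 0 (u * n + v) != 0) = A u v || (u == v)) /\
    (forall r u v, u < n -> v < n ->
       (arr s' 2 ((r * n + u) * n + v) != 0) = partial_reach n A 0 r u v)).
Proof.
move=> r0 a0 a2.
apply: (runs_leq (N := n * (3 + 3) + 3)); first by lia.
apply: (runs_for (m := n) (I := fun i s' =>
    (forall u v, u < n -> v < n ->
       (arr s' 0 (u * n + v) != 0) = A u v || (u == v) && (u < i)) /\
    (forall r u v, u < n -> v < n ->
       (arr s' 2 ((r * n + u) * n + v) != 0) = [&& r == 0, u == v & u < i])) L_gt0) => //.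
- by lia.
- by move=> s' fr /=; rewrite (fr.1 0 isT).
- split=> [u v un vn|r u v un vn] /=; first by rewrite andbF orbF a0.
  by rewrite a2 !andbF.
- move=> i s' ilt ri fr [I0 I2].
  apply: (runs_seq (N1 := 1) (N2 := 1) L_gt0) => //.
  apply: runs_write => //=; first by lia.
  apply: runs_write => //=; first by lia.
  rewrite ri (fr.1 0 isT) r0; split=> [u v un vn|r u v un vn].
    rewrite code_inj // (fun_if (fun z => z != 0)) I0 // ltnS [u <= i]leq_eqVlt.
    case: (eqVneq u i) => [->|]; case: (eqVneq v i) => [->|] //=; rewrite ?eqxx ?orbT //.
  have -> : i * n + i = (0 * n + i) * n + i by [].
  rewrite !code_inj // (fun_if (fun z => z != 0)) I2 // ltnS [u <= i]leq_eqVlt.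
  case: (r == 0) => //=.
  have [->|//] := eqVneq u i.
  by rewrite ltnn [i == v]eq_sym andbF andbT /=; case: ifP.
move=> s' _ _ [I0 I2]; split=> [u v un vn|r u v un vn]; first by rewrite I0 // un andbT.
rewrite I2 // un andbT; case: r => //= r; symmetry; by apply/hasP=> -[w _].
Qed.

Lemma runs_reach s :
  reg s 0 = n -> reg s 1 = d ->
  (forall u v, u < n -> v < n ->
       (arr s 0 (u * n + v) != 0) = A u v || (u == v)) ->
  (forall r u v, u < n -> v < n ->
       (arr s 2 ((r * n + u) * n + v) != 0) = partial_reach n A 0 r u v) ->
  runs reach_com s (10 * M + 3) (fun s' =>
    forall r u v, r <= d - 1 -> u < n -> v < n ->
       (arr s' 2 ((r * n + u) * n + v) != 0) = nat_reach n A r u v).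
Proof.
move=> r0 r1 a0 a2.
apply: (runs_leq (N := M * (6 + 3) + 3)); first by lia.
apply: (runs_for (m := M) (I := fun i s' =>
    (forall r u v, u < n -> v < n ->
       (arr s' 2 ((r * n + u) * n + v) != 0) = partial_reach n A i r u v)) L_gt0) => //.
- by lia.
- move=> s' fr /=; rewrite !fr.1 // r0 r1 M_def !expnS expn0 muln1; lia.
- move=> i s' ilt ri fr I2.
  have r0' : reg s' 0 = n by rewrite fr.1.
  pose c := i %/ n; pose w := i %% n; pose ru := c %/ n; pose v := c %% n.
  pose r := ru %/ n; pose u := ru %% n.
  have wn : w < n by rewrite ltn_mod.
  have vn : v < n by rewrite ltn_mod.
  have un : u < n by rewrite ltn_mod.
  have eru : ru = r * n + u by apply: divn_eq.
  have ec : c = (r * n + u) * n + v by rewrite -eru; apply: divn_eq.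
  have ei : i = ((r * n + u) * n + v) * n + w by rewrite -ec; apply: divn_eq.
  have iL : i < L by lia.
  apply: (runs_seq (N1 := 1) (N2 := 4) L_gt0) => //.
  apply: runs_assign => //=; rewrite ri r0' -/c.
    by apply: leq_ltn_trans (leq_div _ _) _.
  apply: (runs_seq (N1 := 1) (N2 := 2) L_gt0) => //.
  have ew : i - c * n = w by rewrite ei -ec addKn.
  apply: runs_assign => //=; rewrite ri r0' ew.
    by apply: leq_ltn_trans (leq_mod _ _) _.
  apply: runs_if => //=; rewrite r0' -/ru.
  have -> : c - ru * n = v by rewrite ec -eru addKn.
  (* Layer [r] is final by now: the rounds that write it have numbers below [r * n ^ 3 <= i]. *)
  have -> : (arr s' 2 (ru * n + w) * arr s' 0 (w * n + v) != 0)
      = nat_reach n A r u w && (A w v || (w == v)).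
    rewrite muln_eq0 negb_or eru I2 // (fr.2 0 _ isT) a0 // partial_reach_full //.
    rewrite ei !expnS expn0 muln1; nia.
  case: ifP => cond.
    apply: runs_write => //=; first by lia.
    move=> r' u' v' u'n v'n; rewrite r0' (partial_reachS A r' u'n v'n un vn wn ei).
    rewrite cond andbT ec.
    have -> : (r * n + u) * n + v + n * n = (r.+1 * n + u) * n + v by rewrite mulSn; nia.
    rewrite !code_inj // -andbA; case: ifP; first by rewrite orbT.
    by rewrite orbF => _; apply: I2.
  apply: runs_skip => //= r' u' v' u'n v'n.
  rewrite (partial_reachS A r' u'n v'n un vn wn ei) cond !andbF orbF.
  exact: I2.
move=> s' _ _ I2 r u v rd un vn; rewrite I2 // partial_reach_full //.
by rewrite M_def leq_mul2r rd orbT.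
Qed.

End DistanceTables.

(** * Scattered sets and balls *)

Section Reach.
Variables (T : finType) (E : rel T).

Fixpoint reach (r : nat) (u v : T) : bool :=
  if r is r'.+1 then [exists w, reach r' u w && (E w v || (w == v))]
  else u == v.

Lemma reach_refl r u : reach r u u.
Proof.
elim: r => [|r IH] /=; first exact: eqxx.
by apply/existsP; exists u; rewrite IH eqxx orbT.
Qed.

Lemma reachD r1 r2 u v :
  reach (r1 + r2) u v <-> exists2 w, reach r1 u w & reach r2 w v.
Proof.
elim: r2 v => [|r2 IH] v; rewrite ?addn0 ?addnS /=.
  by split=> [?|[w uw /eqP<-]] //; exists v.
split=> [/existsP[w /andP[/IH[w' uw' w'w] wv]]|[w uw /existsP[w' /andP[ww' w'v]]]].
  by exists w' => //; apply/existsP; exists w; rewrite w'w.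
apply/existsP; exists w'; rewrite w'v andbT; apply/IH; by exists w.
Qed.

Lemma reach_leq r1 r2 u v : r1 <= r2 -> reach r1 u v -> reach r2 u v.
Proof.
by move=> /subnKC<- uv; apply/reachD; exists v => //; apply: reach_refl.
Qed.

Lemma reach_sym r u v : symmetric E -> reach r u v = reach r v u.
Proof.
move=> symE; suff: forall u v, reach r u v -> reach r v u.
  by move=> h; apply/idP/idP; apply: h.
elim: r => [|r IH] {}u {}v; first by rewrite /= eq_sym.
case/existsP=> w /andP[uw wv]; rewrite -add1n; apply/reachD; exists w; last exact: IH.
by apply/existsP; exists v; rewrite eqxx symE eq_sym.
Qed.

Lemma walk_reach k u v : walk E u v k -> reach k u v.
Proof.
case/existsP=> -[p szp] /= /andP[pp /eqP lp]; move/eqP: szp => szp.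
elim/last_ind: p k v pp szp lp => [|p w IH] k v /=; first by move=> _ <- -> /=; rewrite eqxx.
rewrite rcons_path size_rcons last_rcons => /andP[pp ew] <- <- /=.
by apply/existsP; exists (last u p); rewrite (IH (size p)) // ew.
Qed.

Lemma reach_walk r u v : reach r u v -> exists2 k, k <= r & walk E u v k.
Proof.
elim: r v => [|r IH] v /=.
  by move/eqP->; exists 0 => //; apply/existsP; exists [tuple]; rewrite /= eqxx.
case/existsP=> w /andP[/IH[k kr /existsP[p /andP[pp /eqP lp]]]].
case/orP=> [wv|/eqP<-]; last first.
  by exists k; rewrite ?leqW //; apply/existsP; exists p; rewrite pp lp eqxx.
exists k.+1 => //; apply/existsP.
have sz : size (rcons p v) == k.+1 by rewrite size_rcons size_tuple.
by exists (Tuple sz); rewrite /= rcons_path pp lp wv last_rcons eqxx.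
Qed.

Lemma walk_connect u v k : walk E u v k -> connect E u v.
Proof.
by case/existsP=> p /andP[pp /eqP lp]; apply/connectP; exists p; rewrite ?lp.
Qed.

Lemma dist_geq_reach d u v : dist_geq E d.+1 u v = ~~ reach d u v.
Proof.
rewrite /dist_geq /dist.
(* Abstracting the reflection proof and then its boolean index opens the dependent match in [dist]
   to case analysis. *)
move: (@idP (connect E u v)); move: {2}(connect E u v) => b [uv|nuv]; last first.
  by symmetry; apply/negP=> /reach_walk[k _ /walk_connect].
case: ex_minnP => m wm mmin; apply/idP/negP => [dm /reach_walk[k kd /mmin]|nr].
  lia.
by rewrite ltnNge; apply/negP=> md; case: nr; apply: reach_leq md (walk_reach wm).
Qed.

Lemma scatteredP d (K : {set T}) :
  reflect {in K &, forall u v, u != v -> ~~ reach d u v} (scattered E d.+1 K).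
Proof.
apply: (iffP forall_inP) => [h u v uK vK uv|h u uK].
  by have /forall_inP/(_ v vK)/implyP/(_ uv) := h u uK; rewrite dist_geq_reach.
by apply/forall_inP=> v vK; apply/implyP=> uv; rewrite dist_geq_reach h.
Qed.

Definition ball (r : nat) (u : T) : {set T} := [set v | reach r u v].

(** Let [m > h] be the distance from [v] to [u]. A vertex [i] steps from [v] and [m - i] steps from
    [u] cannot be closer to [v], by minimality of [m]. The [p i] are chosen one by one and need not
    lie on a common path. *)
Lemma geodesic_vertex h r v u :
  reach r v u -> ~~ reach h v u ->
  exists p : nat -> T, forall i, i <= h ->
    [/\ reach i v (p i), reach (r - i) (p i) u
      & forall i', i' < i -> ~~ reach i' v (p i)].
Proof.
move=> rvu nhvu; case: (ex_minnP (ex_intro (fun r => reach r v u) r rvu)).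
move=> m mvu mmin; have hm : h < m.
  by rewrite ltnNge; apply: contra nhvu => /reach_leq; apply.
have mr := mmin _ rvu.
pose P i w := reach i v w && reach (m - i) w u.
have ex i : i <= h -> exists w, P i w.
  move=> ih; have /reachD[w vw wu] : reach (i + (m - i)) v u by rewrite subnKC //; lia.
  by exists w; rewrite /P vw.
exists (fun i => odflt v [pick w | P i w]) => i ih.
case: pickP => [w /andP[vw wu]|none] /=; last by case: (ex i ih) => w; rewrite none.
split=> // [|i' i'i].
  by apply: reach_leq wu; rewrite leq_sub2r.
apply/negP=> i'w; have : reach (i' + (m - i)) v u by apply/reachD; exists w.
by move/mmin; lia.
Qed.

End Reach.

Section Scattered.
Variables (T : finType) (E : rel T) (h : nat).
Hypothesis symE : symmetric E.

Local Notation reach := (reach E).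
Local Notation ball := (ball E).

Lemma reach_double w u v : reach h u w -> reach h v w -> reach h.*2 u v.
Proof.
move=> uw vw; rewrite -addnn; apply/reachD; exists w => //.
by rewrite reach_sym.
Qed.

(* Let [u1] in [K'] be farther than [h] from [v]: the ball around [v] contains *)
(* the [h.+1] first vertices of a geodesic to [u1] and, for every other [u] in *)
(* [K'], a further vertex that is within distance [h] of [u] only.             *)
Lemma card_scattered_near (K : {set T}) v :
  scattered E h.*2.+1 K ->
  let K' := [set u in K | reach h.*2 v u] in
  1 < #|K'| -> #|K'| + h <= #|ball h v|.
Proof.
move=> /scatteredP sc K' K'gt1.
have scK' : {in K' &, forall u u', reach h.*2 u u' -> u = u'}.
  move=> u u'; rewrite !inE => /andP[uK _] /andP[u'K _] uu'.
  by apply/eqP; apply/idPn => /(sc u u' uK u'K); rewrite uu'.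
have [u1 u1K' far1] : exists2 u1, u1 \in K' & ~~ reach h v u1.
  case/card_gt1P: K'gt1 => a [b [aK bK ab]].
  case va: (reach h v a); last by exists a; rewrite ?va.
  exists b => //; apply/negP=> vb; case/eqP: ab; apply: scK' => //.
  by apply: (@reach_double v); rewrite reach_sym.
have near u : u \in K' -> reach h.*2 v u by rewrite inE => /andP[].
have [p pP] := geodesic_vertex (near _ u1K') far1.
pose P := [set p (nat_of_ord i) | i : 'I_h.+1].
have pinj : injective (fun i : 'I_h.+1 => p i).
  move=> i j eij; apply/val_inj/eqP; case: (ltngtP (val i) (val j)) => // ij.
    have [_ _ /(_ _ ij)] := pP j (ltn_ord j); rewrite -eij.
    by have [-> _ _] := pP i (ltn_ord i).
  have [_ _ /(_ _ ij)] := pP i (ltn_ord i); rewrite eij.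
  by have [-> _ _] := pP j (ltn_ord j).
have cardP : #|P| = h.+1 by rewrite card_imset // card_ord.
pose good u w := [&& reach h v w, reach h w u & w \notin P].
have ex u : u \in K' -> u != u1 -> exists w, good u w.
  (* If [u] is within [h] of [v], take [u] itself: were it some [p i], it would be within [2 h] of
     [u1]. Otherwise take a vertex at distance exactly [h] from [v] on the way to [u]. It is no
     [p i] with [i < h], and if it were [p h], it would be within [h] of both [u] and [u1]. *)
  move=> uK' uu1; case vu: (reach h v u).
    exists u; rewrite /good vu reach_refl /=; apply/imsetP=> -[i _ eu].
    case/eqP: uu1; apply: scK' => //; rewrite eu.
    have [_ r _] := pP i (ltn_ord i); by apply: reach_leq r; apply: leq_subr.
  have [p' p'P] := geodesic_vertex (near _ uK') (negbT vu).
  have [vw wu lev] := p'P h (leqnn h).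
  have wu' : reach h (p' h) u by apply: reach_leq wu; lia.
  exists (p' h); rewrite /good vw wu'; apply/imsetP=> -[i _ ew].
  have [vi iu1 _] := pP i (ltn_ord i).
  have : (val i < h) || (val i == h) by have := ltn_ord i; rewrite ltnS leq_eqVlt orbC.
  case/orP=> [ih|/eqP ih]; first by have := lev _ ih; rewrite ew vi.
  case/eqP: uu1; apply: scK' => //; apply: (@reach_double (p' h)).
    by rewrite reach_sym.
  rewrite reach_sym // ew; apply: reach_leq iu1; rewrite ih; lia.
pose g u := odflt v [pick w | good u w].
have gP u : u \in K' :\ u1 -> good u (g u).
  rewrite in_setD1 /g => /andP[uu1 uK']; case: pickP => //= none.
  by case: (ex u uK' uu1) => w; rewrite none.
have ginj : {in K' :\ u1 &, injective g}.
  move=> a b aK bK eg; have /and3P[_ ga _] := gP a aK.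
  have /and3P[_ gb _] := gP b bK.
  case/setD1P: aK => _ aK; case/setD1P: bK => _ bK; apply: scK' => //.
  by apply: (@reach_double (g a)); rewrite reach_sym // eg.
have cardg : #|g @: (K' :\ u1)| = #|K'|.-1.
  by rewrite card_in_imset // (cardsD1 u1 K') u1K'.
have dis : [disjoint g @: (K' :\ u1) & P].
  apply/pred0P=> w /=; apply/negbTE/negP=> /andP[/imsetP[u uK ->]].
  by have /and3P[_ _ /negbTE->] := gP u uK.
have : g @: (K' :\ u1) :|: P \subset ball h v.
  apply/subsetP=> w; rewrite inE => /orP[/imsetP[u uK ->]|/imsetP[i _ ->]].
    by have /and3P[vg _ _] := gP u uK; rewrite inE.
  have [vi _ _] := pP i (ltn_ord i); rewrite inE.
  by apply: reach_leq vi; rewrite -ltnS.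
move/subset_leq_card; rewrite cardsU disjoint_setI0 // cards0 cardg cardP; lia.
Qed.

(** A vertex common to two balls would bring their centres within [2 h]; hence the double count of
    pairs (centre, ball element) meets each vertex at most once. *)
Lemma card_scattered_large_balls (Y : {set T}) b :
  scattered E h.*2.+1 Y -> {in Y, forall y, b <= #|ball h y|} ->
  #|Y| * b <= #|T|.
Proof.
move=> /scatteredP sc big.
have disj w : #|[set y in Y | w \in ball h y]| <= 1.
  rewrite leqNgt; apply/negP=> /card_gt1P[y [z []]]; rewrite !inE.
  move=> /andP[yY yw] /andP[zY zw] yz; have /negP[] := sc _ _ yY zY yz.
  exact: reach_double yw zw.
rewrite -sum_nat_const -sum1_card.
apply: leq_trans (_ : \sum_(y in Y) #|ball h y| <= _); first exact: leq_sum.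
rewrite (eq_bigr (fun y => \sum_(w : T) (w \in ball h y : nat))); last first.
  by move=> y _; rewrite -sum1_card big_mkcond; apply: eq_bigr => w _; case: ifP.
rewrite exchange_big; apply: leq_sum => w _; apply: leq_trans (disj w).
rewrite -sum1_card big_mkcond [leqRHS]big_mkcond; apply: leq_sum => y _.
by rewrite !inE; case: (y \in Y) => //=; case: reach.
Qed.

End Scattered.

(** * Correctness of the program *)

(** Around a vertex of [S] there is either at most one vertex of [K], and [1 <= f], or
    [card_scattered_near] leaves at most [(h + f) - h]. *)
Lemma card_greedy_covered (T : finType) (E : rel T) h f (K S : {set T}) :
  symmetric E -> scattered E h.*2.+1 K -> 0 < f ->
  {in S, forall s, #|ball E h s| <= h + f} ->
  #|[set u in K | [exists s in S, reach E h.*2 s u]]| <= #|S| * f.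
Proof.
move=> symE sc f_gt0 small; rewrite -sum_nat_const.
pose K' s := [set u in K | reach E h.*2 s u].
apply: leq_trans (_ : #|\bigcup_(s in S) K' s| <= _).
  apply/subset_leq_card/subsetP=> u; rewrite inE => /andP[uK /exists_inP[s sS su]].
  by apply/bigcupP; exists s; rewrite // inE uK.
apply: leq_trans (_ : \sum_(s in S) #|K' s| <= _).
  apply: (big_ind2 (fun (A : {set T}) m => #|A| <= m)) => [|A a B b Aa Bb|//].
    by rewrite cards0.
  by apply: leq_trans (leq_card_setU A B) _; apply: leq_add.
apply: leq_sum => s sS; case: (leqP #|K' s| 1) => [le1|gt1]; first by lia.
by have := card_scattered_near symE sc gt1; have := small s sS; rewrite -/(K' s); lia.
Qed.

(** Register 6 receives [floor (n / (q (h + f + 1))) + 1]. Two is written as a sum because [small]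
    admits no constant above 1. *)
Definition prep_com : com :=
  4 <~ rd [/] (one [+] one) ;;
  5 <~ Reg 4 [+] Reg 2 [/] Reg 3 ;;
  6 <~ rn [*] Reg 3 [/] (Reg 2 [*] (Reg 5 [+] one)) [+] one.

Definition scattered_prog : com :=
  prep_com ;; diag_com ;; reach_com ;; greedy_com ;; search_com.

(** * From program data to vertex sets *)

Lemma init_adjacency n d q (E : rel 'I_n) (u v : 'I_n) :
  (arr (init_state d q E) 0 (u * n + v) != 0) = E u v.
Proof.
rewrite /= eqb0 negbK; apply/existsP/idP=> [[u' /existsP[v']]|Euv].
  rewrite code_inj // => /andP[/andP[/eqP uu' /eqP vv']].
  by rewrite (val_inj uu') (val_inj vv').
by exists u; apply/existsP; exists v; rewrite eqxx.
Qed.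

Lemma nat_reach_ord n (E : rel 'I_n) (A : rel nat) :
  (forall u v : 'I_n, A u v = E u v) ->
  forall r (u v : 'I_n), nat_reach n A r u v = reach E r u v.
Proof.
move=> AE; elim=> [|r IH] u v //=.
apply/hasP/existsP=> [[w]|[w /andP[uw wv]]].
  rewrite mem_iota_ltn => wn /andP[uw wv]; exists (Ordinal wn).
  by rewrite -(IH u (Ordinal wn)) -(AE (Ordinal wn) v) -val_eqE /= uw.
by exists (nat_of_ord w); rewrite ?mem_iota_ltn // IH uw AE.
Qed.

Section OrdSets.
Variables (n r : nat) (E : rel 'I_n) (cl : rel nat).
Hypothesis symE : symmetric E.
Hypothesis clE : forall u v : 'I_n, cl u v = reach E r u v.

Definition ord_set (st : seq nat) : {set 'I_n} := [set v | val v \in st].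

Lemma card_ord_set st :
  uniq st -> all (fun v => v < n) st -> #|ord_set st| = size st.
Proof.
move=> ust stn; rewrite cardE -(size_map val); apply/perm_size/uniq_perm => //.
  by rewrite map_inj_uniq ?enum_uniq //; apply: val_inj.
move=> x; apply/mapP/idP=> [[y]|xst]; first by rewrite mem_enum inE => h ->.
have xn := allP stn x xst; exists (Ordinal xn) => //.
by rewrite mem_enum inE.
Qed.

Lemma scattered_packing st :
  packing n cl st -> scattered E r.+1 (ord_set st).
Proof.
move=> pk; apply/scatteredP=> u v; rewrite !inE -clE.
case/andP: pk => _; elim: st => //= x st IH /andP[/allP xst pw].
rewrite !inE => /orP[/eqP ux|ust] /orP[/eqP vx|vst] uv.
- by case/eqP: uv; apply: val_inj; rewrite /= ux vx.
- by rewrite ux; apply: xst.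
- by rewrite clE reach_sym // -clE vx; apply: xst.
by apply: IH.
Qed.

Lemma packing_scattered st :
  uniq st -> all (fun v => v < n) st -> scattered E r.+1 (ord_set st) ->
  packing n cl st.
Proof.
move=> ust stn /scatteredP sc; rewrite /packing stn /=.
have {}sc : {in st &, forall u v, u != v -> ~~ cl u v}.
  move=> u v ust' vst uv.
  have := sc (Ordinal (allP stn u ust')) (Ordinal (allP stn v vst)).
  by rewrite !inE -clE => /(_ ust' vst)/(_ uv).
elim: st ust {stn} sc => //= x st IH /andP[xst ust] sc; apply/andP; split.
  apply/allP=> y yst; apply: sc; rewrite ?inE ?eqxx ?yst ?orbT //.
  by apply: contraNneq xst => ->.
by apply: IH => // u v ust' vst; apply: sc; rewrite inE ?ust' ?vst orbT.
Qed.

Lemma covers_set st k o (Z : {set 'I_n}) :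
  packing n cl st -> uniq st -> covers n cl st 0 k o ->
  #|Z| <= k -> [disjoint ord_set st & Z] ->
  scattered E r.+1 (ord_set st :|: Z) -> size st + #|Z| <= size o.
Proof.
move=> pk ust cov Zk dis sc.
have eZ : size (map val (enum Z)) = #|Z| by rewrite size_map cardE.
rewrite -eZ; have stn : all (fun v => v < n) st by case/andP: pk.
have Zn : all (fun v => v < n) (map val (enum Z)).
  by apply/allP=> x /mapP[y _ ->]; apply: ltn_ord.
have memZ (v : 'I_n) : (val v \in map val (enum Z)) = (v \in Z).
  by rewrite mem_map ?mem_enum //; apply: val_inj.
apply: cov; rewrite ?eZ //.
- rewrite sorted_map; apply: sorted_filter; first by move=> x y z; apply: ltn_trans.
  by rewrite -enumT -sorted_map val_enum_ord iota_ltn_sorted.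
- by apply/allP.
apply: packing_scattered.
- rewrite cat_uniq ust map_inj_uniq ?enum_uniq ?andbT; last exact: val_inj.
  apply/hasPn=> x /mapP[y yZ ->]; rewrite mem_enum in yZ.
  by apply/negP=> yst; move/pred0P: dis => /(_ y) /=; rewrite inE yst yZ.
- by rewrite all_cat stn.
rewrite (_ : ord_set _ = ord_set st :|: Z) //; apply/setP=> v.
by rewrite !inE mem_cat memZ.
Qed.

End OrdSets.

Lemma count_ball n (E : rel 'I_n) h (nb : rel nat) (x : 'I_n) :
  (forall u v : 'I_n, nb u v = reach E h u v) ->
  count (nb x) (iota 0 n) = #|ball E h x|.
Proof.
move=> nbE; rewrite -val_enum_ord count_map enumT cardE /enum_mem size_filter.
by apply: eq_count => v /=; rewrite nbE inE.
Qed.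

(** The interface between program and combinatorics, with [S] the greedy set and [O] the output: the
    ratio is derived from these facts about the run. *)
Definition greedy_outcome n (E : rel 'I_n) (d thr k : nat) (S O : {set 'I_n}) : Prop :=
  [/\ scattered E d O,
      {in S, forall v, #|ball E d./2 v| <= thr},
      scattered E d S,
      forall v, #|ball E d./2 v| <= thr -> [exists s in S, reach E (d - 1) s v]
    & forall Z : {set 'I_n}, #|Z| <= k -> [disjoint S & Z] ->
        scattered E d (S :|: Z) -> #|S| + #|Z| <= #|O|].

Lemma runs_scattered_prog L M n d (q : rat) (E : rel 'I_n) (num den : nat) :
  symmetric E -> 0 < n -> 0 < d ->
  num = `|numq q|%N -> den = `|denq q|%N -> 0 < den -> den <= num ->
  M = (d - 1) * n ^ 3 -> M + 8 * n + d + num %/ den + 10 < L ->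
  let thr := d./2 + num %/ den in
  let k := (n * den) %/ (num * thr.+1) + 1 in
  runs L scattered_prog (init_state d q E)
    (visits n k * iter_steps n + (10 * M + 20 * (n + 1) ^ 2 + 14 * n + 60))
    (fun s => exists S, greedy_outcome E d thr k S (output n s)).
Proof.
move=> symE n_gt0 d_gt0 enum eden den_gt0 le_den eM L_large thr k.
set s0 := init_state d q E.
have L_gt0 : 0 < L by lia.
have d2 : d %/ 2 = d./2 by rewrite divn2.
have dh : d./2 <= d - 1 by lia.
have kn : k <= n + 1.
  rewrite /k leq_add2r -ltnS ltn_divLR; last by rewrite muln_gt0; lia.
  nia.
pose A : rel nat := fun u v => arr s0 0 (u * n + v) != 0.
have AE (u v : 'I_n) : A u v = E u v by apply: init_adjacency.
pose cl := nat_reach n A (d - 1); pose nb := nat_reach n A d./2.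
have clE (u v : 'I_n) : cl u v = reach E (d - 1) u v by apply: nat_reach_ord.
have nbE (u v : 'I_n) : nb u v = reach E d./2 u v by apply: nat_reach_ord.
have clr u : u < n -> cl u u.
  by move=> un; have := clE (Ordinal un) (Ordinal un) => /= ->; apply: reach_refl.
have LL : 4 * n + thr + 4 < L by rewrite /thr; lia.
set V := visits n k * iter_steps n.
apply: (runs_seq (N1 := 5) (N2 := V + (10 * M + 20 * (n + 1) ^ 2 + 14 * n + 54)) L_gt0).
  by lia.
apply: (@runs_weaken _ _ _ 5 _ (fun s1 : state =>
   [/\ reg s1 4 = d./2, reg s1 5 = thr & reg s1 6 = k])) => //; last first.
  apply: (runs_seq (N1 := 1) (N2 := 3) L_gt0) => //.
  apply: runs_assign => //=; rewrite d2; first by lia.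
  apply: (runs_seq (N1 := 1) (N2 := 1) L_gt0) => //.
  apply: runs_assign => //=; rewrite -enum -eden -/thr; first by rewrite /thr; lia.
  by apply: runs_assign => //=; rewrite -enum -eden ?addn1 -addn1 -/k; first by lia.
move=> s1 fr1 [r4 r5 r6].
have r0 : reg s1 0 = n by rewrite fr1.1.
have a0 u v : u < n -> v < n -> (arr s1 0 (u * n + v) != 0) = A u v.
  by rewrite fr1.2.
apply: (runs_seq (N1 := 6 * n + 3)
  (N2 := V + (10 * M + 20 * (n + 1) ^ 2 + 8 * n + 50)) L_gt0).
  by lia.
have L2 : M + n + 2 < L by lia.
have a2 i : arr s1 2 i = 0 by rewrite fr1.2.
apply: runs_weaken (runs_diag n_gt0 eM L2 r0 a0 a2) => // s2 fr2 [a0_2 a2_2].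
apply: (runs_seq (N1 := 10 * M + 3) (N2 := V + (20 * (n + 1) ^ 2 + 8 * n + 46)) L_gt0).
  by lia.
have r0_2 : reg s2 0 = n by rewrite fr2.1.
have r1_2 : reg s2 1 = d by rewrite fr2.1 // fr1.1.
apply: runs_weaken (runs_reach n_gt0 eM L2 r0_2 r1_2 a0_2 a2_2) => // s3 fr3 a2_3.
have tb3 : tables n d d./2 thr cl nb s3.
  split; first by split; rewrite fr3.1 // fr2.1.
  by move=> u v un vn; split; apply: a2_3.
apply: (runs_seq (N1 := 20 * (n + 1) ^ 2) (N2 := V + (8 * n + 40)) L_gt0).
  by lia.
apply: runs_weaken (runs_greedy LL clr tb3) => // s4 fr4 [st [Sst pst smst cov4]].
have tb4 : tables n d d./2 thr cl nb s4 by apply: tables_frame fr4 _ _ _.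
have b4 : best n s4 [::].
  split; first by rewrite fr4.1 // fr3.1 // fr2.1 // fr1.1.
  by move=> v vn; rewrite fr4.2 // fr3.2 // fr2.2 // fr1.2.
have r6_4 : reg s4 6 = k by rewrite fr4.1 // fr3.1 // fr2.1.
apply: runs_weaken (runs_search LL clr kn tb4 Sst pst b4 r6_4) => //.
move=> s5 _ [o [[_ bo] po cov5]].
have outE : output n s5 = ord_set n o by apply/setP=> v; rewrite !inE bo.
have ust := packing_uniq clr pst; have stn : all (fun v => v < n) st by case/andP: pst.
have uo := packing_uniq clr po; have on : all (fun v => v < n) o by case/andP: po.
have dS : d = (d - 1).+1 by lia.
exists (ord_set n st); rewrite /greedy_outcome outE !card_ord_set //; split.
- by rewrite {1}dS; apply: scattered_packing po.
- move=> v; rewrite inE => vst; rewrite -(count_ball _ nbE).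
  exact: (allP smst _ vst).
- by rewrite {1}dS; apply: scattered_packing pst.
- move=> v; rewrite -(count_ball _ nbE) => /(cov4 _ (ltn_ord v))/hasP[x xst xv].
  have xn := allP stn x xst; apply/exists_inP; exists (Ordinal xn); first by rewrite inE.
  by rewrite -clE.
by move=> Z Zk dis; rewrite {1}dS => sc; apply: covers_set cov5 Zk dis sc.
Qed.

(** Here [a] counts the vertices of an optimum within [2 h] of [S] and [b] the others. Any [c] of
    the others extend [S] to a scattered set that the search has considered. *)
Lemma greedy_outcome_ratio n (E : rel 'I_n) (d f k : nat) (S O : {set 'I_n}) :
  symmetric E -> odd d -> 0 < f ->
  greedy_outcome E d (d./2 + f) k S O ->
  exists a b c : nat, [/\ OPT E d = a + b, a <= #|S| * f,
     b * (d./2 + f).+1 <= n, c = minn b k & #|S| + c <= #|O|].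
Proof.
move=> symE odd_d f_gt0 [_ smS scS covS covZ].
have ed : d = (d./2).*2.+1 by rewrite -{1}[d](odd_double_half) odd_d.
have [|K scK eK] := @eq_bigmax_cond _ (scattered E d) (fun K : {set 'I_n} => #|K|).
  by apply/card_gt0P; exists set0; apply/forall_inP=> u; rewrite inE.
rewrite (_ : OPT E d = #|K|); last exact: eK.
have {}scK : scattered E d K by exact: scK.
pose K1 := [set u in K | [exists s in S, reach E (d./2).*2 s u]].
have e2 : d - 1 = (d./2).*2 by rewrite {1}ed subn1.
rewrite e2 in covS.
have K1K : K1 \subset K by apply/subsetP=> u; rewrite inE => /andP[].
pose K2 := K :\: K1.
have scK2 : scattered E d K2.
  rewrite ed; apply/scatteredP=> u v; rewrite !inE => /andP[_ uK] /andP[_ vK].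
  by rewrite ed in scK; move/scatteredP: scK; apply.
have bigK2 : {in K2, forall y, (d./2 + f).+1 <= #|ball E d./2 y|}.
  move=> y; rewrite !inE => /andP[+ yK]; rewrite yK /= ltnNge.
  by apply: contra => /covS.
exists #|K1|, #|K2|, (minn #|K2| k); split=> //.
- by rewrite cardsD (setIidPr K1K) subnKC // subset_leq_card.
- by apply: card_greedy_covered; rewrite -?ed.
- rewrite -[leqRHS]card_ord; apply: card_scattered_large_balls bigK2 => //.
  by rewrite -ed.
have [Z ZK2 cZ] : exists2 Z : {set 'I_n}, Z \subset K2 & #|Z| = minn #|K2| k.
  exists [set x in take k (enum K2)].
    by apply/subsetP=> x; rewrite inE => /mem_take; rewrite mem_enum.
  rewrite cardsE (card_uniqP _) ?take_uniq ?enum_uniq // size_take -cardE.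
  by rewrite /minn; case: ltngtP.
rewrite -cZ; apply: covZ.
- by rewrite cZ geq_minr.
- apply/pred0P=> x /=; apply/negbTE/negP=> /andP[xS /(subsetP ZK2)].
  rewrite !inE => /andP[+ xK]; rewrite xK /= => /negP[].
  by apply/exists_inP; exists x => //; apply: reach_refl.
rewrite ed; apply/scatteredP.
have farSZ s z : s \in S -> z \in Z -> ~~ reach E (d./2).*2 s z.
  move=> sS /(subsetP ZK2); rewrite !inE => /andP[+ zK]; rewrite zK /=.
  by apply: contra => sz; apply/exists_inP; exists s.
move=> u v; rewrite !inE => /orP[uS|uZ] /orP[vS|vZ] uv.
- by rewrite ed in scS; move/scatteredP: scS; apply.
- exact: farSZ.
- by rewrite reach_sym //; apply: farSZ.
by rewrite ed in scK2; move/scatteredP: scK2; apply=> //; apply: (subsetP ZK2).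
Qed.

(** * Counting the searched sets *)

(** With [2] added, the recursion of [visits] becomes Pascal's rule for partial sums of binomial
    coefficients. *)
Lemma visits_binomial m j : visits m j + 2 <= 2 * \sum_(i < j.+1) 'C(m, i).
Proof.
elim: m j => [|m IH] [|j] /=; try by rewrite big_ord_recl bin0; lia.
have := IH j; have := IH j.+1.
suff -> : \sum_(i < j.+2) 'C(m.+1, i) =
    \sum_(i < j.+2) 'C(m, i) + \sum_(i < j.+1) 'C(m, i).
  by lia.
rewrite big_ord_recl [X in _ = X + _]big_ord_recl !bin0 -addnA -big_split /=.
by congr addn; apply: eq_bigr => i _; rewrite /bump /= add1n binS.
Qed.

Import Order.TTheory GRing.Theory Num.Theory.
Local Open Scope ring_scope.

Lemma pow_fact_expR (R : realType) (x : R) i : 0 <= x -> x ^+ i / i`!%:R <= expR x.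
Proof.
move=> x0; case: i => [|i].
  by rewrite expr0 fact0 divr1 (le_trans _ (expR_ge1Dx x)) // lerDl.
by apply: le_trans (expR_ge1Dxn i x0); rewrite lerDr.
Qed.

Lemma ffact_leq_expn n i : (n ^_ i <= n ^ i)%N.
Proof.
elim: i n => [|i IH] n //; rewrite ffactnS expnS leq_mul2l.
apply/orP; right; apply: leq_trans (IH _) _; case: i {IH} => // i.
by rewrite leq_exp2r // leq_pred.
Qed.

(** Combine [C(n, i) <= n^i / i!] with the fact that [x^i / i!] is a term of the series of [e^x];
    [x] is free to be chosen. *)
Lemma bin_expR (R : realType) n i (x : R) :
  0 < x -> ('C(n, i))%:R <= expR x * (n%:R / x) ^+ i.
Proof.
move=> x0; have f0 : 0 < (i`!)%:R :> R by rewrite ltr0n fact_gt0.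
apply: (@le_trans _ _ (x ^+ i / i`!%:R * (n%:R / x) ^+ i)); last first.
  by rewrite ler_wpM2r ?exprn_ge0 ?divr_ge0 ?(ltW x0) // pow_fact_expR // ltW.
have -> : x ^+ i / i`!%:R * (n%:R / x) ^+ i = n%:R ^+ i / i`!%:R.
  have : x ^+ i != 0 by rewrite expf_neq0 // gt_eqF.
  rewrite expr_div_n; move: (x ^+ i) (n%:R ^+ i) => p p' p0.
  by field; rewrite p0 gt_eqF.
by rewrite ler_pdivlMr // -natrM -natrX ler_nat bin_ffact ffact_leq_expn.
Qed.

Lemma sum_bin_expR (R : realType) n k (x : R) :
  0 < x -> x <= n%:R ->
  (\sum_(i < k.+1) 'C(n, i))%:R <= k.+1%:R * (expR x * (n%:R / x) ^+ k).
Proof.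
move=> x0 xn; rewrite natr_sum.
have y1 : 1 <= n%:R / x by rewrite ler_pdivlMr // mul1r.
apply: le_trans (_ : \sum_(i < k.+1) expR x * (n%:R / x) ^+ k <= _).
  apply: ler_sum => i _; apply: le_trans (bin_expR _ _ x0) _.
  by rewrite ler_wpM2l ?expR_ge0 // ler_weXn2l // -ltnS.
by rewrite sumr_const card_ord [leRHS]mulr_natl.
Qed.

(** * Inequalities that bring base and exponent into the stated form *)

Lemma ln_ge_1BV (R : realType) (x : R) : 0 < x -> 1 - x^-1 <= ln x.
Proof.
move=> x0; have xV0 : 0 < x^-1 by rewrite invr_gt0.
have := @le_ln1Dx R (x^-1 - 1); rewrite [1 + _]addrC subrK lnV // => h.
by have := h ltac:(lra); lra.
Qed.

(** This amounts to [(d + 1) (ln rho - ln d) <= (2 rho - 2) ln d]. The left side is bounded by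
    [ln t <= t - 1] at [t = rho / d], the right side by [ln d >= 1 - 1 / d >= 2 / 3]. *)
Lemma ln_ratio_bound (R : realType) (d rho : R) :
  3 <= d -> d <= rho ->
  (d + rho) * (2 * ln rho) <= (d - 1 + 2 * rho) * (ln rho + ln d).
Proof.
move=> d3 drho; have d0 : 0 < d by lra. have rho0 : 0 < rho by lra.
have ld : 2 / 3 <= ln d.
  apply: le_trans (ln_ge_1BV d0).
  have : d^-1 <= 3^-1 by rewrite lef_pV2 ?posrE.
  lra.
have lr : ln rho - ln d <= rho / d - 1.
  rewrite -ln_div ?posrE //.
  have := @le_ln1Dx R (rho / d - 1); rewrite [1 + _]addrC subrK; apply.
  have : 0 < rho / d by rewrite divr_gt0.
  lra.
have key : (d + 1) * (rho / d - 1) <= (2 * rho - 2) * (2 / 3).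
  rewrite -(ler_pM2l d0).
  have -> : d * ((d + 1) * (rho / d - 1)) = (d + 1) * (rho - d) by field; lra.
  nra.
have h1 : (d + 1) * (ln rho - ln d) <= (d + 1) * (rho / d - 1).
  by rewrite ler_pM2l //; lra.
have h2 : (2 * rho - 2) * (2 / 3) <= (2 * rho - 2) * ln d.
  by rewrite ler_wpM2l //; lra.
lra.
Qed.

(* For [rho > d] the base [rho (d + rho) / 2] exceeds [rho d]; this is paid    *)
(* for by the exponent, which is smaller than on the right-hand side.          *)
Lemma powR_exponent_tradeoff (R : realType) (d rho c : R) :
  3 <= d -> 1 <= rho -> 0 <= c ->
  (rho * (d + rho) / 2) `^ (c / (d - 1 + 2 * rho)) <= (rho * d) `^ (c / (d + rho)).
Proof.
move=> d3 rho1 c0; set y := _ / 2.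
have y1 : 1 <= y by rewrite /y; nra.
have D0 : 0 < d + rho by lra.
have D'0 : 0 < d - 1 + 2 * rho by lra.
have X'X : c / (d - 1 + 2 * rho) <= c / (d + rho).
  by rewrite ler_wpM2l // lef_pV2 ?posrE //; lra.
(* If [rho <= d], then [y <= rho * d] and the left exponent is the smaller one. Otherwise
   [y <= rho ^ 2], and taking logarithms leads to [ln_ratio_bound]. *)
have [led|ltd] := leP rho d.
  apply: le_trans (ler_powR y1 X'X) _.
  apply: ge0_ler_powR; rewrite ?nnegrE ?divr_ge0 //; rewrite /y; nra.
have rho0 : 0 < rho by lra. have d0 : 0 < d by lra.
have y0 : 0 < y by lra.
have rd0 : 0 < rho * d by rewrite mulr_gt0.
rewrite /powR !gt_eqF // ler_expR lnM ?posrE //.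
have lny : ln y <= 2 * ln rho.
  have -> : 2 * ln rho = ln (rho ^+ 2) by rewrite lnXn // mulr_natl.
  by rewrite ler_ln ?posrE ?exprn_gt0 // /y; nra.
rewrite -!mulrA; apply: ler_wpM2l => //.
rewrite -(ler_pM2l D'0) mulrA divff ?gt_eqF // mul1r.
rewrite -(ler_pM2l D0) [X in _ <= X]mulrCA [(d + rho) * (_^-1 * _)]mulrA.
rewrite divff ?gt_eqF // mul1r.
apply: le_trans (ln_ratio_bound d3 (ltW ltd)); by rewrite ler_pM2l.
Qed.

(** The hypotheses give [a <= n / P] for [P = q (h + q)]. As [rho] exceeds [q] by at most [1 / n],
    passing to [P' = rho (h + rho)] costs at most 1: [n (P' - P) <= h + rho + q <= P P']. *)
Lemma exponent_rounding (R : realType) (n h rho q b a : R) :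
  0 < n -> 1 <= h -> 1 <= q -> q <= rho -> rho <= q + n^-1 -> h + q <= b ->
  0 <= a -> a * (b * q) <= n -> a <= n / (rho * (h + rho)) + 1.
Proof.
move=> n0 h1 q1 qrho rhoq hb a0 abq.
have P'0 : 0 < rho * (h + rho) by nra.
have P2 : 2 <= q * (h + q) by nra.
have P'h : h + rho <= rho * (h + rho) by nra.
have nrho : n * (rho - q) <= 1.
  by rewrite -(mulfV (lt0r_neq0 n0)) ler_pM2l //; lra.
rewrite -lerBlDr ler_pdivlMr //.
set P := q * (h + q) in P2; set P' := rho * (h + rho) in P'0 P'h *.
have aP : a * P <= n.
  by apply: le_trans abq; rewrite /P [q * _]mulrC ler_wpM2l // ler_wpM2r //; lra.
have nPP : n * (P' - P) <= P * P'.
  have -> : n * (P' - P) = n * (rho - q) * (h + rho + q) by rewrite /P /P'; ring.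
  apply: (@le_trans _ _ (h + rho + q)); first by nra.
  nra.
have P0 : 0 < P by lra.
rewrite -(ler_pM2l P0).
have : a * P * P' <= n * P' by rewrite ler_pM2r.
lra.
Qed.

(** Take [x = X] in [sum_bin_expR], so that [n / X = y]. Since [a + 1 <= X' + 2], two spare factors
    [y] remain beside [y^X'], and [4 n^4] absorbs them. *)
Lemma sum_bin_search (R : realType) (n d a : nat) (rho q b : R) :
  odd d -> (3 <= d)%N -> (0 < n)%N ->
  1 <= rho -> rho <= n%:R -> 1 <= q -> q <= rho -> rho <= q + n%:R^-1 ->
  (d./2)%:R + q <= b -> a%:R * (b * q) <= n%:R ->
  rho * (d%:R + rho) / 2 <= 2 * n%:R ^+ 2 ->
  (\sum_(i < a.+2) 'C(n, i))%:R <=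
    a.+2%:R * (4 * n%:R ^+ 4) *
    (expR 1 * rho * d%:R) `^ (2 * n%:R / (rho * (d%:R + rho))).
Proof.
move=> odd_d d3 n_gt0 rho1 rhon q1 qrho rhoq hb abq yn.
have n0 : 0 < n%:R :> R by rewrite ltr0n.
have d3' : 3 <= d%:R :> R by rewrite (ler_nat R 3).
have h1 : 1 <= (d./2)%:R :> R by rewrite ler1n; lia.
have dh : d%:R = 2 * (d./2)%:R + 1 :> R.
  rewrite -{1}[d](odd_double_half) odd_d add1n -addn1 natrD -muln2 natrM mulrC //.
set y := _ / 2 in yn *; set X := 2 * n%:R / _.
have y1 : 1 <= y by rewrite /y; nra.
have D0 : 0 < rho * (d%:R + rho) by nra.
have X0 : 0 < X by rewrite divr_gt0 // mulr_gt0.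
have yX : n%:R / X = y by rewrite /X /y; field; rewrite !gt_eqF //; lra.
have D2 : 2 <= rho * (d%:R + rho) by nra.
have Xn : X <= n%:R by rewrite /X ler_pdivrMr // [leLHS]mulrC ler_pM2l.
apply: le_trans (sum_bin_expR a.+1 X0 Xn) _; rewrite yX -!mulrA.
apply: ler_wpM2l; first exact: ler0n.
have -> : (expR 1 * (rho * d%:R)) `^ X = expR X * (rho * d%:R) `^ X.
  rewrite powRM ?expR_ge0 //; last by nra.
  by rewrite -expRM mul1r.
rewrite [leRHS](_ : _ = expR X * (4 * n%:R ^+ 4 * (rho * d%:R) `^ X)); last by ring.
apply: ler_wpM2l; first exact: expR_ge0.
set c := 2 * n%:R / rho.
have c0 : 0 <= c by rewrite divr_ge0 //; nra.
have eX : c / (d%:R + rho) = X by rewrite /c /X invfM !mulrA.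
pose X' := c / (d%:R - 1 + 2 * rho).
have eX' : X' = n%:R / (rho * ((d./2)%:R + rho)).
  by rewrite /X' /c dh; field; rewrite !gt_eqF //; lra.
have aX : a%:R <= X' + 1.
  by rewrite eX'; apply: exponent_rounding rhoq hb _ abq.
have trade : y `^ X' <= (rho * d%:R) `^ X.
  by rewrite -eX; apply: powR_exponent_tradeoff.
have y0 : 0 <= y by lra.
have ya : y ^+ a.+1 <= y ^+ 2 * y `^ X'.
  rewrite exprS expr2 -mulrA; apply: ler_wpM2l => //.
  rewrite -powR_mulrn //; apply: le_trans (ler_powR y1 aX) _.
  rewrite powRD ?powRr1 // 1?mulrC //.
  by rewrite implybE orbC gt_eqF //; lra.
apply: le_trans ya _; apply: ler_pM => //; rewrite ?exprn_ge0 ?powR_ge0 //.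
have -> : 4 * n%:R ^+ 4 = (2 * n%:R ^+ 2) ^+ 2 :> R by ring.
by rewrite lerXn2r // nnegrE //; lra.
Qed.

(** * Polynomial overheads and the final bound *)

Lemma bounded_init L n d (q : rat) (E : rel 'I_n) :
  (input_size n d q <= L)%N -> bounded L (init_state d q E).
Proof.
move=> IL; have L_gt0 : (0 < L)%N by move: IL; rewrite /input_size /bitlen; lia.
split=> [x|a i].
  have lt v : (bitlen v <= input_size n d q)%N -> (v < 2 ^ L)%N.
    by move=> vI; apply: ltn_exp2_bitlen; apply: leq_trans IL.
  case: x => [|[|[|[|x]]]] /=; try by apply: lt; rewrite /input_size; lia.
  by rewrite nth_nil expn_gt0.
rewrite /=; case: (_ && _) => /=; last by rewrite expn_gt0.
by rewrite -[1%N]/(2 ^ 0)%N ltn_exp2l.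
Qed.

Lemma overhead_bounds (n d f I M : nat) :
  (0 < n)%N -> (d <= 3 * n)%N -> (f <= n)%N -> (n <= I)%N ->
  M = ((d - 1) * n ^ 3)%N ->
  (M + 8 * n + d + f + 11 + I <= 30 * I ^ 4)%N /\
  (iter_steps n + (10 * M + 20 * (n + 1) ^ 2 + 14 * n + 60) <= 300 * I ^ 4)%N.
Proof.
move=> n0 d3 fn nI eM; set J := (I ^ 4)%N.
have I0 : (0 < I)%N by lia.
have IJ : (I <= J)%N by rewrite -[X in (X <= _)%N]expn1 leq_pexp2l.
have I2J : (I ^ 2 <= J)%N by rewrite leq_pexp2l.
have n2 : (n ^ 2 <= I ^ 2)%N by rewrite leq_exp2r.
have MJ : (M <= 3 * J)%N.
  rewrite eM; apply: (@leq_trans (3 * n * n ^ 3)).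
    by rewrite leq_mul2r; apply/orP; right; lia.
  by rewrite -mulnA -expnS leq_mul2l leq_exp2r.
split; first by lia.
by rewrite /iter_steps sqrnD; lia.
Qed.

Lemma rat_num_den (R : realType) (q : rat) :
  1 <= q -> [/\ (0 < `|denq q|)%N, (`|denq q| <= `|numq q|)%N
    & ratr q * `|denq q|%:R = `|numq q|%:R :> R].
Proof.
move=> q1; have den0 : (0 < `|denq q|)%N by rewrite absz_gt0 denq_neq0.
have num0 : 0 <= numq q by rewrite numq_ge0; apply: le_trans q1.
have eR : ratr q * `|denq q|%:R = `|numq q|%:R :> R.
  rewrite !pmulrn absz_denq (gez0_abs num0) /ratr mulfVK //.
  by rewrite intr_eq0 denq_neq0.
split=> //; rewrite -(ler_nat R) -eR ler_peMl ?ler0n //.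
by rewrite -(rmorph1 (ratr : {rmorphism rat -> R})) ler_rat.
Qed.

Lemma leq_input_size n d (q : rat) : (0 < n)%N -> (n <= input_size n d q)%N.
Proof.
move=> n0; rewrite /input_size -!addnA.
exact: leq_trans (leq_pmulr n n0) (leq_addr _ _).
Qed.

Lemma output_ratio (R : realType) (n d num den : nat) (E : rel 'I_n) (rho q : R)
    (S O : {set 'I_n}) :
  symmetric E -> odd d -> (0 < den)%N -> (den <= num)%N ->
  q * den%:R = num%:R -> 1 <= rho -> q <= rho ->
  let thr := (d./2 + num %/ den)%N in
  greedy_outcome E d thr (n * den %/ (num * thr.+1)).+1 S O ->
  (OPT E d)%:R / rho <= #|O|%:R.
Proof.
move=> symE odd_d den0 lednum eqR rho1 qrho; set f := (num %/ den)%N => thr.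
set a := (n * den %/ (num * thr.+1))%N => out.
have den0R : 0 < den%:R :> R by rewrite ltr0n.
have f0 : (0 < f)%N by rewrite divn_gt0.
have rho0 : 0 <= rho by apply: le_trans rho1.
have fq : f%:R <= q.
  by rewrite -(ler_pM2r den0R) eqR -natrM ler_nat leq_trunc_div.
have nthr0 : (0 < num * thr.+1)%N by rewrite muln_gt0 (leq_trans den0).
have [x [y [c [-> xS yb ec cO]]]] := greedy_outcome_ratio symE odd_d f0 out.
rewrite ler_pdivrMr; last by apply: lt_le_trans rho1.
have xr : x%:R <= #|S|%:R * rho.
  apply: (@le_trans _ _ (#|S|%:R * f%:R)); first by rewrite -natrM ler_nat.
  by rewrite ler_wpM2l ?ler0n //; apply: le_trans qrho.
have yr : y%:R <= c%:R * rho.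
  (* If [y] exceeds [a.+1], the rounding in [a] gives [y * thr.+1 <= n < a.+1 * q * thr.+1], so
     [a.+1] extra vertices lose at most the factor [q]. *)
  rewrite ec; case: (leqP y a.+1) => [ya|ay]; first by rewrite ler_peMr ?ler0n.
  apply: (@le_trans _ _ (a.+1%:R * q)); last by rewrite ler_wpM2l ?ler0n.
  rewrite -(ler_pM2r den0R) -mulrA eqR -!natrM ler_nat.
  rewrite -(leq_pmul2r (ltn0Sn thr)) -[X in (_ <= X)%N]mulnA.
  apply: leq_trans (ltnW (ltn_ceil _ nthr0)).
  by rewrite mulnAC leq_mul2r yb orbT.
rewrite natrD; apply: (@le_trans _ _ ((#|S| + c)%:R * rho)).
  by rewrite natrD mulrDl lerD.
by rewrite ler_wpM2r ?ler_nat.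
Qed.

(** The constant 24 is 2 from [visits_binomial], 3 from [a + 2 <= 3 I], and 4 from
    [sum_bin_search]. *)
Lemma visits_bound (R : realType) (n d num den I thr : nat) (rho q : R) :
  odd d -> (3 <= d)%N -> (0 < n)%N -> (0 < den)%N -> (den <= num)%N ->
  q * den%:R = num%:R -> 1 <= q -> 1 <= rho -> rho <= n%:R -> q <= rho ->
  rho <= q + n%:R^-1 -> (d <= 3 * n)%N -> (n <= I)%N ->
  thr = (d./2 + num %/ den)%N ->
  (visits n (n * den %/ (num * thr.+1)).+1).+1%:R <=
    24%:R * I%:R ^+ 5 *
    (expR 1 * rho * d%:R) `^ (2 * n%:R / (rho * (d%:R + rho))).
Proof.
move=> odd_d d3 n0 den0 lednum eqR q1 rho1 rhon qrho rhoq d3n nI thrE.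
set a := (n * den %/ (num * thr.+1))%N.
have den0R : 0 < den%:R :> R by rewrite ltr0n.
have qf : q <= (num %/ den).+1%:R.
  by rewrite -(ler_pM2r den0R) eqR -natrM ler_nat ltnW // ltn_ceil.
have d3R : d%:R <= 3 * n%:R :> R by rewrite -natrM ler_nat.
have aR : a%:R * (thr.+1%:R * q) <= n%:R.
  rewrite -(ler_pM2r den0R) -!mulrA eqR [_ * num%:R]mulrC -!natrM ler_nat.
  exact: leq_trunc_div.
have hb : (d./2)%:R + q <= thr.+1%:R by rewrite thrE -addnS natrD lerD2l.
have yn : rho * (d%:R + rho) / 2 <= 2 * n%:R ^+ 2.
  have d0R : 0 <= d%:R :> R by exact: ler0n.
  by rewrite expr2; clear -d0R d3R rhon rho1; nra.
have := sum_bin_search odd_d d3 n0 rho1 rhon q1 qrho rhoq hb aR yn.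
set B := _ `^ _ => sumB; have B0 : 0 <= B by exact: powR_ge0.
have an : (a <= n)%N.
  rewrite -(ler_nat R); apply: le_trans aR; rewrite ler_peMr ?ler0n //.
  have t1 : 1 <= thr.+1%:R :> R by rewrite ler1n.
  by clear -t1 q1; nra.
have := visits_binomial n a.+1; set Sg := (\sum_(i < _) _)%N in sumB *.
move=> vis; apply: (@le_trans _ _ (2%:R * Sg%:R)).
  by rewrite -natrM ler_nat; apply: leq_trans vis; rewrite addn2 ltnW.
apply: (@le_trans _ _ (2%:R * (a.+2%:R * (4 * n%:R ^+ 4) * B))).
  by rewrite ler_pM2l ?ltr0n.
rewrite [leLHS]mulrA; apply: ler_wpM2r => //.
have a2 : a.+2%:R <= 3 * I%:R :> R.
  by rewrite -natrM ler_nat; clear -an nI n0; lia.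
have n4 : n%:R ^+ 4 <= I%:R ^+ 4 :> R by rewrite lerXn2r ?nnegrE ?ler0n ?ler_nat.
have := ler_pM (ler0n R _) (exprn_ge0 4 (ler0n R n)) a2 n4.
rewrite [_ ^+ 5]exprS; move: (n%:R ^+ 4) (I%:R ^+ 4) => u v; clear; lra.
Qed.

(** The exponent 17 is 5 for the iterations, 4 for the steps of an iteration together with the
    set-up, and 8 for the square of [L <= 30 I^4] in the cost of a step. [V.+1] lets the set-up
    count as one more iteration. *)
Lemma total_cost (R : realType) (n d f I M L V t : nat) (B : R) :
  (0 < n)%N -> (d <= 3 * n)%N -> (f <= n)%N -> (n <= I)%N ->
  M = ((d - 1) * n ^ 3)%N -> L = (M + 8 * n + d + f + 11 + I)%N ->
  (t <= (V * iter_steps n + (10 * M + 20 * (n + 1) ^ 2 + 14 * n + 60)) *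
        unit_cost L)%N ->
  V.+1%:R <= 24%:R * I%:R ^+ 5 * B ->
  t%:R <= (300 * 24 * (3000 * 30 ^ 2))%N%:R * I%:R ^+ 17 * B.
Proof.
move=> n0 d3n fn nI eM eL tN VB.
have [LI NI] := overhead_bounds n0 d3n fn nI eM; rewrite -eL in LI.
have tR : (t <= (V.+1 * (300 * I ^ 4)) * (3000 * (30 * I ^ 4) ^ 2))%N.
  apply: leq_trans tN _; apply: leq_mul; last by rewrite leq_mul2l leq_exp2r // LI orbT.
  apply: leq_trans (leq_mul (leqnn V.+1) NI).
  by clear; move: (iter_steps n) (10 * M + _ + _ + _)%N => u v; nia.
move: tR; rewrite -(ler_nat R) => /le_trans; apply.
rewrite !(natrM, natrX).
move: (300%:R : R) (ler0n R 300) (24%:R : R) (3000%:R : R) (ler0n R 3000)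
  (30%:R : R) (ler0n R 30) (I%:R : R) (ler0n R I) VB.
move=> c1 c1_ge0 c2 c3 c3_ge0 c4 c4_ge0 i i_ge0 VB.
apply: (@le_trans _ _ (c2 * i ^+ 5 * B * (c1 * i ^+ 4) * (c3 * (c4 * i ^+ 4) ^+ 2))).
  apply: ler_wpM2r; first apply: mulr_ge0 => //.
    by apply: exprn_ge0; rewrite mulr_ge0 ?exprn_ge0.
  by apply: ler_wpM2r => //; rewrite mulr_ge0 ?exprn_ge0.
rewrite le_eqVlt; apply/orP; left; apply/eqP; clear; ring.
Qed.

Theorem theorem10 (R : realType) :
  exists (prog : com) (C k : nat),
  forall (d n : nat) (rho : R) (q : rat) (E : rel 'I_n),
    odd d -> (3 <= d)%N ->
    1 <= rho -> rho <= n%:R / (d./2)%:R ->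
    1 <= q -> ratr q <= rho -> rho <= ratr q + n%:R^-1 ->
    symmetric E -> irreflexive E ->
    exists (t : nat) (s : state),
      [/\ exec prog (init_state d q E) t s,
          scattered E d (output n s),
          (OPT E d)%:R / rho <= #|output n s|%:R
        & t%:R <= C%:R * (input_size n d q)%:R ^+ k *
            (expR 1 * rho * d%:R)
              `^ (2 * n%:R / (rho * (d%:R + rho)))].
Proof.
exists scattered_prog, (300 * 24 * (3000 * 30 ^ 2))%N, 17%N.
move=> d n rho q E odd_d d3 rho1 rhoh q1 qrho rhoq symE _.
have [den0 lednum eqR] := rat_num_den R q1.
have qR1 : 1 <= ratr q :> R.
  by rewrite -(rmorph1 (ratr : {rmorphism rat -> R})) ler_rat.
have rho0 : 0 <= rho by apply: le_trans rho1.
have h0 : (0 < d./2)%N by rewrite half_gt0 (leq_trans _ d3).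
have hn : rho * (d./2)%:R <= n%:R by rewrite -ler_pdivlMr // ltr0n.
have rhon : rho <= n%:R by apply: le_trans hn; rewrite ler_peMr ?ler1n.
have hn' : (d./2 <= n)%N by rewrite -(ler_nat R) (le_trans _ hn) // ler_peMl ?ler0n.
have n0 : (0 < n)%N by apply: leq_trans hn'.
have d3n : (d <= 3 * n)%N by clear -hn' n0; lia.
have d_gt0 : (0 < d)%N by apply: leq_trans d3.
have fn : (`|numq q| %/ `|denq q| <= n)%N.
  rewrite -(ler_nat R) (le_trans _ rhon) // (le_trans _ qrho) //.
  by rewrite -(ler_pM2r (_ : 0 < `|denq q|%:R)) ?ltr0n // eqR -natrM ler_nat leq_trunc_div.
have nI := leq_input_size d q n0.
move eM : ((d - 1) * n ^ 3)%N => M.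
(* This [L] exceeds every number the program stores, as the step rules demand, and also the bit
   lengths of all input numbers. *)
move eL : (M + 8 * n + d + `|numq q| %/ `|denq q| + 11 + input_size n d q)%N => L.
have L_large : (M + 8 * n + d + `|numq q| %/ `|denq q| + 10 < L)%N.
  by rewrite -eL [X in (_ < X + _)%N]addnS leq_addr.
have bL : bounded L (init_state d q E) by apply: bounded_init; rewrite -eL leq_addl.
have := runs_scattered_prog symE n0 d_gt0 erefl erefl den0 lednum (esym eM) L_large.
case/(_ bL) => t [s [ex tN _ _ [S out]]].
rewrite addn1 in tN out.
exists t, s; split=> //; first by case: out.
  exact: (output_ratio symE odd_d den0 lednum eqR rho1 qrho out).
apply: (total_cost n0 d3n fn nI (esym eM) (esym eL) tN).
exact: (visits_bound odd_d d3 n0 den0 lednum eqR).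
Qed.
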